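(* Let $m,n\in\mathbb{N}$, let $K\subset\mathbb{R}^n$ be a convex body containing the origin, and set $\gamma_K(x)=e^{-\|x\|_K^2/2}$ for $x\in\mathbb{R}^n$. Then $$R_0^m\gamma_K=\sqrt{2}\,\exp\left(\tfrac12\psi\left(1+\tfrac n2\right)\right)R_0^mK,$$ and, for every $p>0$, $$R_p^m\gamma_K=\sqrt2\left(\frac{\Gamma\left(1+\frac{n+p}{2}\right)}{\Gamma\left(1+\frac n2\right)}\right)^{1/p}R_p^mK .$$ In particular, $$\lim_{p\to\infty}\Gamma(1+p)^{-1/p}R_p^m\gamma_K=\{o\}$$ (limit in the Hausdorff metric).
   Context: A convex body is a compact convex set with nonempty interior. $\|x\|_K=\inf\{t>0:x\in tK\}\in[0,\infty]$ is the gauge of $K$ (with $e^{-\infty}=0$). $\psi=\Gamma'/\Gamma$ is the digamma function; $o$ is the origin. Write $\bar x=(x_1,\dots,x_m)\in(\mathbb{R}^n)^m=\mathbb{R}^{nm}$ and $x_0=o$. For a convex body $K$ let $g_{K,m}(\bar x)=\mathrm{vol}_n\left(K\cap\bigcap_{i=1}^m(x_i+K)\right)$, and for an integrable log-concave $f:\mathbb{R}^n\to[0,\infty)$ let $g_{f,m}(\bar x)=\int_{\mathbb{R}^n}\min_{0\le i\le m}f(y-x_i)\,dy$. For $g=g_{K,m}$ or $g=g_{f,m}$ (whose maximum is $g(\bar o)=\mathrm{vol}_n(K)$, respectively $g(\bar o)=\|f\|_1=\int f$), the body $R_p^mK$, respectively $R_p^mf$, is the star-shaped set in $\mathbb{R}^{nm}$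 with radial function ($\bar\theta\in\mathbb{S}^{nm-1}$) $$\rho(\bar\theta)=\left(\frac{p}{g(\bar o)}\int_0^\infty g(r\bar\theta)r^{p-1}dr\right)^{1/p}\ (p>0),\qquad \rho(\bar\theta)=\exp\left(\int_0^\infty\left(-\frac{\partial}{\partial r}\frac{g(r\bar\theta)}{g(\bar o)}\right)\log r\,dr\right)\ (p=0).$$ The star-shaped set with radial function $\rho$ is $\{r\bar\theta:\bar\theta\in\mathbb{S}^{nm-1},\,0\le r\le\rho(\bar\theta)\}$. *)

(* Defs.v *)
From HB Require Import structures.
From mathcomp Require Import all_boot all_order all_algebra.
From mathcomp Require Import all_classical all_reals all_analysis.
Import Order.TTheory GRing.Theory Num.Theory.
Import numFieldNormedType.Exports.

Set Implicit Arguments.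
Unset Strict Implicit.
Unset Printing Implicit Defensive.

Local Open Scope classical_set_scope.
Local Open Scope ring_scope.

(* R^n is 'rV[R]_n and (R^n)^m = R^(nm) is 'M[R]_(m, n), the i-th point of
   x : 'M[R]_(m, n) being row i x.  The library has no Lebesgue measure on R^n;
   it is built on n.-tuple R, with its product sigma-algebra, by iterating the
   binary product measure, and read on row vectors through row_of_tuple. *)

Section image_cons.
Context {d} {T : measurableType d} {R : realType}.

Definition cons_pair n (x : T * n.-tuple T) : n.+1.-tuple T :=
  [tuple of x.1 :: x.2].

Lemma measurable_cons_pair n : measurable_fun setT (@cons_pair n).
Proof. exact: measurable_cons. Qed.

Variables (n : nat) (mu : {sigma_finite_measure set T -> \bar R}).
Variable nu : {sigma_finite_measure set n.-tuple T -> \bar R}.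

Definition image_cons : set (n.+1.-tuple T) -> \bar R :=
  pushforward (mu \x nu)%E (@cons_pair n).

Let image_cons0 : image_cons set0 = 0%E.
Proof. by rewrite /image_cons /pushforward preimage_set0 measure0. Qed.

Let image_cons_ge0 A : (0 <= image_cons A)%E.
Proof. exact: (measure_ge0 (mu \x nu)%E). Qed.

Let image_cons_sigma_additive : semi_sigma_additive image_cons.
Proof.
move=> F mF tF mUF; rewrite /image_cons /pushforward preimage_bigcup.
have mpre A : measurable A -> measurable (@cons_pair n @^-1` A).
  by move=> mA; rewrite -[X in measurable X]setTI; exact: measurable_cons_pair.
apply: (measure_semi_sigma_additive (s := (mu \x nu)%E)) => [k||].
- exact: mpre (mF k).
- apply/trivIsetP => /= i j _ _ ij; rewrite -preimage_setI.
  by move/trivIsetP : tF => /(_ _ _ _ _ ij) ->//; rewrite preimage_set0.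
- by rewrite -preimage_bigcup; exact: mpre.
Qed.

HB.instance Definition _ := isMeasure.Build _ _ _ image_cons
  image_cons0 image_cons_ge0 image_cons_sigma_additive.

Lemma sigma_finite_image_cons : sigma_finite setT image_cons.
Proof.
have /sigma_finiteP[F [TF ndF Foo]] := sigma_finiteT mu.
have /sigma_finiteP[G [TG ndG Goo]] := sigma_finiteT nu.
pose u (t : n.+1.-tuple T) : T * n.-tuple T := (thead t, [tuple of behead t]).
have mu_ : measurable_fun setT u.
  apply/measurable_fun_pair; first exact: measurable_tnth.
  exact: measurable_behead.
have uK x : u (cons_pair x) = x.
  by case: x => a t; rewrite /u /cons_pair /=; congr pair; exact/val_inj.
have FG k : measurable (F k `*` G k).
  by have [? _] := Foo k; have [? _] := Goo k; exact: measurableX.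
exists (fun k => u @^-1` (F k `*` G k)) => [|k].
  rewrite -preimage_bigcup (_ : \bigcup_i _ = setT) ?preimage_setT//.
  rewrite -subTset -setXTT TF TG => -[x y] [/= [i _ Fx] [j _ Gy]].
  exists (maxn i j) => //; split.
  - by move: x Fx; exact/subsetPset/ndF/leq_maxl.
  - by move: y Gy; exact/subsetPset/ndG/leq_maxr.
split; first by rewrite -[X in measurable X]setTI; exact: mu_.
have [? ?] := Foo k; have [? ?] := Goo k.
rewrite /image_cons /pushforward -comp_preimage.
rewrite (_ : u \o _ = id) ?preimage_id; last exact/funext.
by rewrite product_measure1E// lte_mul_pinfty// ge0_fin_numE.
Qed.

HB.instance Definition _ := Measure_isSigmaFinite.Build _ _ _ image_cons
  sigma_finite_image_cons.

End image_cons.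

Section lebesgue_Rn.
Context {R : realType}.

Fixpoint lebesgue_tuple n :
    {sigma_finite_measure set n.-tuple (measurableTypeR R) -> \bar R} :=
  if n is n'.+1 then
    image_cons (@lebesgue_measure R) (lebesgue_tuple n')
  else \d_[tuple].

Lemma lebesgue_tuple_box n (A : 'I_n -> set (measurableTypeR R)) :
  (forall i, measurable (A i)) ->
  lebesgue_tuple n [set t | forall i, A i (tnth t i)] =
  (\prod_(i < n) lebesgue_measure (A i))%E.
Proof.
elim: n A => [|n IH] A mA.
  by rewrite big_ord0 /= diracE mem_set// => -[].
have mB m (B : 'I_m -> set (measurableTypeR R)) :
    (forall i, measurable (B i)) ->
    measurable
      [set t : m.-tuple (measurableTypeR R) | forall i, B i (tnth t i)].
  move=> mB.
  rewrite (_ : [set t | _] = \bigcap_(i in [set: 'I_m])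
      ((@tnth m (measurableTypeR R))^~ i @^-1` B i)).
    apply: fin_bigcap_measurable => [|i _]; first exact: finite_finset.
    by rewrite -[X in measurable X]setTI; exact: measurable_tnth.
  by apply/seteqP; split=> t /= Bt i => [_|]; exact: Bt.
rewrite big_ord_recl -(IH (fun i => A (lift ord0 i))) => [|i]; last exact: mA.
rewrite -product_measure1E//; last first.
  by apply: (mB _ (fun i => A (lift ord0 i))) => i; exact: mA.
rewrite /= /image_cons /pushforward; congr (product_measure1 _ _ _).
apply/seteqP; split=> -[a t] /=.
- move=> At; split=> [|i]; first exact: (At ord0).
  by have := At (lift ord0 i); rewrite tnthS.
- move=> [Aa At] i; case: (unliftP ord0 i) => [j ->|->//].
  by rewrite tnthS; exact: At.
Qed.

End lebesgue_Rn.

Section Rn.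
Context {R : realType}.

Definition row_of_tuple n (t : n.-tuple R) : 'rV[R]_n := \row_i tnth t i.

Definition vol n (A : set 'rV[R]_n) : \bar R :=
  lebesgue_tuple n (@row_of_tuple n @^-1` A).

Definition integral_rV n (f : 'rV[R]_n -> R) : R :=
  \int[lebesgue_tuple n]_t f (row_of_tuple t).

Definition euclid_norm m n (x : 'M[R]_(m, n)) : R :=
  Num.sqrt (\sum_i \sum_j x i j ^+ 2).

Definition dilate m n (c : R) (A : set 'M[R]_(m, n)) : set 'M[R]_(m, n) :=
  [set c *: x | x in A].

Definition translate m n (x : 'M[R]_(m, n)) (A : set 'M[R]_(m, n)) :
  set 'M[R]_(m, n) := [set x + y | y in A].

Definition convex_body n (K : set 'rV[R]_n) : Prop :=
  [/\ compact K, convex_set K & interior K !=set0].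

(* The infimum of the empty set is +oo. *)
Definition gauge n (K : set 'rV[R]_n) (x : 'rV[R]_n) : \bar R :=
  ereal_inf [set t%:E | t in [set t : R | 0 < t /\ dilate t K x]].

Definition gaussian n (K : set 'rV[R]_n) (x : 'rV[R]_n) : R :=
  fine (expeR (- (gauge K x ^+ 2 * (2^-1)%:E)))%E.

(* Hausdorff distance for the Euclidean norm, with values in [0, +oo]. *)
Definition hausdorff_excess m n (A B : set 'M[R]_(m, n)) : \bar R :=
  ereal_sup [set ereal_inf [set (euclid_norm (a - b))%:E | b in B] | a in A].

Definition hausdorff m n (A B : set 'M[R]_(m, n)) : \bar R :=
  maxe (hausdorff_excess A B) (hausdorff_excess B A).

Definition Gamma (z : R) : R :=
  \int[lebesgue_measure]_(t in `]0, +oo[) (t `^ (z - 1) * expR (- t)).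

Definition digamma (z : R) : R := derive1 Gamma z / Gamma z.

Definition covariogram m n (K : set 'rV[R]_n) (x : 'M[R]_(m, n)) : R :=
  fine (vol (K `&` \bigcap_(i in [set: 'I_m]) translate (row i x) K)).

(* The seed f y of the iterated minimum is the term of index 0, as x_0 = 0. *)
Definition covariogram_fun m n (f : 'rV[R]_n -> R) (x : 'M[R]_(m, n)) : R :=
  integral_rV (fun y => \big[Num.min/f y]_(i < m) f (y - row i x)).

(* For g coming from a convex body or from an integrable log-concave function
   with nonzero integral, the integrals below are finite, so real-valued ones
   are enough; the derivative need only exist for almost every r, derive1 taking
   an arbitrary value elsewhere. *)
Definition radial m n (g : 'M[R]_(m, n) -> R) (p : R)
    (theta : 'M[R]_(m, n)) : R :=
  if p == 0 then
    expR (\int[lebesgue_measure]_(r in `]0, +oo[)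
            (- derive1 (fun s : R => g (s *: theta) / g 0) r * ln r))
  else
    (p / g 0 * \int[lebesgue_measure]_(r in `]0, +oo[)
                 (g (r *: theta) * r `^ (p - 1))) `^ p^-1.

Definition star_set m n (rho : 'M[R]_(m, n) -> R) : set 'M[R]_(m, n) :=
  [set x | exists theta r,
     [/\ euclid_norm theta = 1, 0 <= r <= rho theta & x = r *: theta]].

(* R_p^m K and R_p^m f. *)
Definition radial_mean_body m n (p : R) (K : set 'rV[R]_n) : set 'M[R]_(m, n) :=
  star_set (radial (@covariogram m n K) p).

Definition radial_mean_body_fun m n (p : R) (f : 'rV[R]_n -> R) :
  set 'M[R]_(m, n) := star_set (radial (@covariogram_fun m n f) p).

End Rn.

Arguments radial_mean_body {R} m {n} p K.
Arguments radial_mean_body_fun {R} m {n} p f.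

(* Main.v *)
Require Import Defs.
From HB Require Import structures.
From mathcomp Require Import all_boot all_order all_algebra.
From mathcomp Require Import all_classical all_reals all_analysis.
From mathcomp Require Import measurable_realfun ring lra.
Import Order.TTheory GRing.Theory Num.Theory.
Import numFieldNormedType.Exports.

(** Why the theorem holds.  The Gaussian [gamma] of [K] takes its values in
    the unit interval, and the set where it is at least [exp (- s)] is the
    dilate of [K] by [tau s = sqrt (2 s)].  Writing the minimum of the
    translates of [gamma] as an integral over levels, and integrating over the
    space first, gives ([covariogram_gaussian])
      g_gamma (x) = int_0^oo exp (- s) (tau s)^n g_K (x / tau s) ds.
    Fix a direction.  Along it, g_K divided by its value at the origin is a
    nonincreasing function from 1 to 0: the tail r |-> P (X > r) of a positive
    random variable [X].  Since (tau s)^n is proportional to s^(n / 2), the formula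
    says that g_gamma, normalised in the same way, is the tail of tau S * X, where
    [S] is independent of [X] and has the Gamma law of density
    s^(n / 2) exp (- s) / Gamma (1 + n / 2).  The radial function at p > 0 is
    (E (X^p))^(1/p), at p = 0 it is exp (E (ln X)).

    For p > 0, E ((tau S)^p) = 2^(p / 2) Gamma (1 + (n + p) / 2) / Gamma (1 + n / 2)
    is the p-th power of the constant in the theorem.  This needs Tonelli's theorem
    and a change of scale only ([gamma_mixture_moment], [radial_gaussian]).

    For p = 0, E (ln (tau S)) = (ln 2 + digamma (1 + n / 2)) / 2, by
    differentiating Gamma under the integral sign ([derive1_Gamma]).  What needs
    an argument is that minus the almost everywhere derivative of a profile is the
    density of its law, so that the integral in the definition is E (ln X).
    Translating [K] by w leaves uncovered a volume O(|w|) ([vol_uncovered_le]); so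
    the profile of [K] is Lipschitz ([ray_lipschitz]), and the law of [X] has
    a bounded density, with bounded support ([exists_density]).  The law of
    tau S * X then has a density as well, a mixture of rescaled ones, and Lebesgue
    differentiation identifies both with minus the derivatives of the tails.
    Boundedness makes the logarithm integrable, so that Fubini's theorem applies
    ([log_moment_mixture_density], [radial_gaussian0]).

    For the limit, the radial functions of [K] at p >= 1 are bounded uniformly
    ([radial_covariogram_le]), and for every A > 0 the p-th root of
    Gamma (1 + (n + p) / 2) / Gamma (1 + p) is asymptotically at most A^(-1/2)
    ([Gamma_half_le], [gamma_ratio_root_le]). *)

Local Open Scope classical_set_scope.
Local Open Scope ring_scope.

(** * Integrals on the line *)

Section integral_tools.
Context {R : realType}.
Local Notation TR := (measurableTypeR R).
Local Notation mu := (@lebesgue_measure R).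
Local Notation Rpos := (`]0%R, +oo[%classic : set TR).

Import HBNNSimple.

(** The integral of a nonnegative function is a supremum over simple functions,
    and clearing a simple function on a null set keeps its integral.  So
    changing a function on a null set is harmless even when the result is not
    measurable, as for [derive1 g], which is arbitrary where [g] has no
    derivative. *)
Lemma ge0_le_integral_off_null d (T : measurableType d)
    (nu : {measure set T -> \bar R}) (D N : set T) (f g : T -> \bar R) :
  measurable N -> nu N = 0%E ->
  (forall x, D x -> 0 <= f x)%E -> (forall x, D x -> 0 <= g x)%E ->
  (forall x, D x -> ~ N x -> f x = g x) ->
  (\int[nu]_(x in D) f x <= \int[nu]_(x in D) g x)%E.
Proof.
move=> mN N0 f0 g0 fg.
rewrite (ge0_integralE _ f0) (ge0_integralE _ g0).
apply: ge_ereal_sup => _ [h hf <-].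
have mNC : measurable (~` N) by exact: measurableC.
pose h' := mul_nnsfun h (indic_nnsfun R mNC).
have -> : sintegral nu h = sintegral nu h'.
  rewrite -!integralT_nnsfun; apply: ge0_ae_eq_integral => //.
  - by apply/measurable_EFinP; exact: measurable_funP.
  - by apply/measurable_EFinP; exact: measurable_funP.
  - by move=> x _; rewrite lee_fin; exact: fun_ge0.
  - by move=> x _; rewrite lee_fin; exact: fun_ge0.
  exists N; split=> // x /= /not_implyP[_]; apply: contra_notP => Nx.
  by rewrite /h' /= mindicE mem_set// mulr1.
apply: ereal_sup_ubound => /=; exists h' => // x.
rewrite /h' /= mindicE.
have gD0 : (0 <= (g \_ D) x)%E.
  by rewrite patchE; case: ifPn => // /set_mem /g0.
case: (pselect (N x)) => Nx; first by rewrite memNset ?mulr0//=; exact/not_notP.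
rewrite mem_set// mulr1; apply: (le_trans (hf x)).
rewrite !patchE; case: ifPn => // /set_mem Dx.
by rewrite fg.
Qed.

Lemma integral_off_null d (T : measurableType d)
    (nu : {measure set T -> \bar R}) (D N : set T) (f g : T -> \bar R) :
  measurable N -> nu N = 0%E -> (forall x, D x -> ~ N x -> f x = g x) ->
  (\int[nu]_(x in D) f x = \int[nu]_(x in D) g x)%E.
Proof.
move=> mN N0 fg.
rewrite integralE [RHS]integralE; congr (_ - _)%E; apply/le_anti/andP;
  split; apply: (@ge0_le_integral_off_null _ _ _ _ N) => // x Dx Nx.
- by rewrite !funeposE fg.
- by rewrite !funeposE fg.
- by rewrite !funenegE fg.
- by rewrite !funenegE fg.
Qed.

Lemma measurable_affine (c b : R) :
  measurable_fun [set: TR] (fun x : TR => (c * x + b)%R : TR).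
Proof.
by apply: measurable_funD => //; apply: measurable_funM.
Qed.

(** Both sides are measures of [A] that agree on the half-open intervals. *)
Lemma lebesgue_measure_affine (c b : R) (A : set TR) : 0 < c -> measurable A ->
  mu ((fun x : TR => (c * x + b)%R : TR) @^-1` A) = (c^-1%:E * mu A)%E.
Proof.
move=> c0 mA.
have c0' : 0 <= c by exact: ltW.
pose nu := mscale (NngNum c0')
  (pushforward (T2 := TR) mu (fun x : TR => (c * x + b)%R : TR)).
have -> : mu A = nu (measurable_affine c b) A.
  apply: lebesgue_measure_unique => // _ [[x y] _ <-] /=.
  rewrite /nu /mscale /= /pushforward.
  have -> : (fun z : TR => (c * z + b)%R : TR) @^-1` `]x, y] =
            `](x - b) / c, (y - b) / c]%classic.
    apply/seteqP; split=> z /=; rewrite !in_itv/= ltr_pdivrMr// ler_pdivlMr//.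
      by move=> /andP[? ?]; apply/andP; split; lra.
    by move=> /andP[? ?]; apply/andP; split; lra.
  rewrite !lebesgue_measure_itv/= !lte_fin.
  rewrite ltr_pM2r ?invr_gt0// ltrD2r; case: ifPn => _; last by rewrite mule0.
  rewrite -!EFinB -EFinM; congr EFin; field; exact: lt0r_neq0.
by rewrite /nu /mscale /= muleA -EFinM mulVf ?mul1e// gt_eqF.
Qed.

Lemma ge0_integral_affine (c b : R) (D : set TR) (f : TR -> \bar R) : 0 < c ->
  measurable D -> measurable_fun D f -> (forall x, D x -> 0 <= f x)%E ->
  (\int[mu]_(x in (fun x : TR => (c * x + b)%R : TR) @^-1` D) f (c * x + b)%R =
   c^-1%:E * \int[mu]_(x in D) f x)%E.
Proof.
move=> c0 mD mf f0.
have mphi := measurable_affine c b.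
have := @ge0_integral_pushforward _ _ TR TR R _ mphi mu D f mD mf.
move=> /= <-; last by move=> y /set_mem; exact: f0.
have ci0 : 0 <= c^-1 by rewrite invr_ge0 ltW.
have := ge0_integral_mscale (lebesgue_measure) mD (NngNum ci0) mf f0.
move=> /= <-.
apply: eq_measure_integral => A mA _.
exact: lebesgue_measure_affine.
Qed.

Lemma ge0_integral_scale (c : R) (f : TR -> \bar R) : 0 < c ->
  measurable_fun Rpos f -> (forall x : R, 0 < x -> (0 <= f x)%E) ->
  (\int[mu]_(x in Rpos) f (c * x)%R = c^-1%:E * \int[mu]_(x in Rpos) f x)%E.
Proof.
move=> c0 mf f0.
rewrite -(@ge0_integral_affine c 0)//; last first.
  by move=> x /=; rewrite in_itv/= andbT; exact: f0.
rewrite (_ : _ @^-1` _ = `]0%R, +oo[%classic); last first.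
  by apply/seteqP; split=> x /=; rewrite !in_itv/= !andbT addr0 pmulr_rgt0.
by apply: eq_integral => x _; rewrite addr0.
Qed.

Lemma continuous_expRN : continuous (fun s : R => expR (- s)).
Proof.
move=> x; apply: (@continuous_comp _ _ _ (fun z : R => - z) expR).
  exact: opp_continuous.
exact: continuous_expR.
Qed.

Lemma ge0_integral_expRN (a : R) :
  (\int[mu]_(s in `[a, +oo[) (expR (- s))%:E = (expR (- a))%:E)%E.
Proof.
have H (x : R) : is_derive x (1 : R) (fun s : R => - expR (- s)) (expR (- x)).
  have -> : (fun s : R => - expR (- s)) = (- (expR \o (@GRing.opp R))) by [].
  by apply: is_derive_eq; rewrite mulrN1 opprK.
rewrite (@ge0_continuous_FTC2y R (fun s => expR (- s)) (fun s => - expR (- s)) _ 0).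
- by rewrite sub0e EFinN oppeK.
- by move=> x _; exact: expR_ge0.
- exact/continuous_subspaceT/continuous_expRN.
- by rewrite -oppr0; apply: cvgN; exact: cvgr_expR.
- by move=> x _; exact: ex_derive.
- by apply: cvg_at_right_filter; apply: cvgN; exact: continuous_expRN.
- by move=> x _; rewrite derive1E derive_val.
Qed.

(** A value in the unit interval as the mass, under the exponential law, of the levels
    [expR (- s)] below it; this turns a function with values there into an
    integral of indicators of its superlevel sets. *)
Lemma layer_cake_expR (v : R) : 0 <= v <= 1 ->
  (\int[mu]_(s in Rpos) (expR (- s) * ((expR (- s) <= v)%R)%:R)%:E = v%:E)%E.
Proof.
move=> /andP[]; rewrite le_eqVlt => /predU1P[<- _|v0 v1].
  apply: integral0_eq => s _.
  by rewrite leNgt expR_gt0/= mulr0.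
have l0 : 0 <= - ln v by rewrite oppr_ge0 ln_le0.
have H s : (expR (- s) <= v) = (- ln v <= s).
  by rewrite -[in LHS](lnK v0) ler_expR lerNl.
have <- : (\int[mu]_(s in `[(- ln v)%R, +oo[) (expR (- s))%:E)%E = v%:E.
  by rewrite ge0_integral_expRN opprK lnK.
(* the two domains may differ at the end point 0, when v = 1 *)
rewrite integral_mkcond [RHS]integral_mkcond.
apply: (@integral_off_null _ TR mu setT [set 0%R]) => //.
  exact: lebesgue_measure_set1.
move=> x _ /eqP x0; rewrite !patchE !mem_setE !in_itv/= !andbT H.
case: ifPn => x0'.
  by case: ifPn; rewrite ?mulr1 ?mulr0.
rewrite ifN// -ltNge; rewrite -leNgt in x0'.
by rewrite (lt_le_trans _ l0)// lt_neqAle x0 x0'.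
Qed.

End integral_tools.

(** * A density for a Lipschitz tail *)

Section density.
Context {R : realType}.
Local Notation TR := (measurableTypeR R).
Local Notation mu := (@lebesgue_measure R).
Local Notation Rpos := (`]0%R, +oo[%classic : set TR).

Lemma lebesgue_stieltjes_ocitv (F : cumulative R R) (a b : R) : a <= b ->
  lebesgue_stieltjes_measure F `]a, b]%classic = (F b - F a)%:E.
Proof.
move=> ab; rewrite /lebesgue_stieltjes_measure /measure_extension.
rewrite measurable_mu_extE/=; last exact: is_ocitv.
by rewrite wlength_itv_bnd.
Qed.

Lemma derive1_cstB (F h : R -> R) (C r d : R) :
  (\forall s \near r, C - F s = h s) -> derivable F r 1 -> derive1 F r = d ->
  derivable h r 1 /\ derive1 h r = - d.
Proof.
move=> near_hF dF F'.
have dCF : derivable (fun s => C - F s) r 1.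
  by apply: derivableB; [exact: derivable_cst|exact: dF].
split; first exact: (@near_eq_derivable R R R (fun s => C - F s) h r 1 near_hF dCF).
rewrite derive1E -(@near_eq_derive R R R (fun s => C - F s) h r 1 near_hF).
rewrite (_ : (fun s => C - F s) = cst C - F)//.
rewrite deriveB; [|exact: derivable_cst|exact: dF].
by rewrite derive_cst sub0r -derive1E F'.
Qed.

(** Lebesgue differentiation: the tail is a constant minus the integral up to
    [r], whose derivative is [phi] almost everywhere. *)
Lemma derive1_tail_integral (h phi : R -> R) :
  mu.-integrable setT (EFin \o phi) ->
  (forall r, 0 < r -> \int[mu]_(s in `]r, +oo[) phi s = h r) ->
  {ae mu, forall r : R, 0 < r -> derivable h r 1 /\ derive1 h r = - phi r}.
Proof.
move=> iphi hE.
have locphi : locally_integrable [set: R] phi.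
  by apply: open_integrable_locally => //; exact: openT.
have iphiNy (y : R) : mu.-integrable `]-oo, y] (EFin \o phi).
  exact: integrableS iphi.
have := FTC1Ny iphiNy locphi.
set F := (F in let _ := F in _); rewrite /=.
apply: filterS; first exact: (ae_filter_ringOfSetsType mu).
move=> r [dF F'] r0.
pose C := \int[mu]_t phi t.
have hF s : 0 < s -> h s = C - F s.
  move=> s0; rewrite -hE// /F /C.
  have := @Rintegral_itvB R phi -oo%O +oo%O s.
  by rewrite set_itvNyy => /(_ iphi) <-.
have near_hF : \forall s \near r, C - F s = h s.
  near=> s; rewrite hF//; near: s.
  exact: lt_nbhsr.
exact: (derive1_cstB F h C r (phi r)).
Unshelve. all: by end_near. Qed.

Lemma derive1_ge_lipschitz (h : R -> R) (L x : R) :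
  (forall a b, a <= b -> h a - h b <= L * (b - a)) ->
  derivable h x 1 -> - L <= derive1 h x.
Proof.
move=> hL dh; rewrite /derive1; apply: limr_ge.
  have /cvg_ex[/= l hl] := dh; apply/cvg_ex; exists l.
  by move: hl; under eq_fun do rewrite scaler1.
near=> k.
have k0 : k != 0 by near: k; exact: nbhs_dnbhs_neq.
have [kp|kn|/eqP] := ltgtP k 0; last by rewrite (negPf k0).
- have := hL (k + x) x; rewrite gerDr => /(_ (ltW kp)) H.
  rewrite /= [_ *: _]mulrC ler_ndivlMr//; lra.
- have := hL x (k + x); rewrite lerDr => /(_ (ltW kn)) H.
  rewrite /= [_ *: _]mulrC ler_pdivlMr//; lra.
Unshelve. all: by end_near. Qed.

Section exists_density.
Variables (h : R -> R) (L D : R).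
Hypothesis h_ni : {homo h : x y /~ x <= y}.
Hypothesis L0 : 0 < L.
Hypothesis hL : forall x y, x <= y -> h x - h y <= L * (y - x).
Hypothesis h1 : forall x, x <= 0 -> h x = 1.
Hypothesis h0 : forall x, D <= x -> h x = 0.

Lemma lipschitz_continuous : continuous h.
Proof.
move=> x; apply/cvgrPdist_le => /= e e0; near=> t.
have tx : `|x - t| <= e / L.
  near: t; apply: cvgr_dist_le; first exact: cvg_id.
  by rewrite divr_gt0.
apply: (@le_trans _ _ (L * `|x - t|)); last first.
  by rewrite mulrC -ler_pdivlMr.
have [xt|tx'] := leP x t.
- have H := hL _ _ xt; have H' := h_ni _ _ xt.
  by rewrite ger0_norm ?subr_ge0// distrC ger0_norm ?subr_ge0.
- have H := hL _ _ (ltW tx'); have H' := h_ni _ _ (ltW tx').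
  by rewrite distrC ger0_norm ?subr_ge0// ger0_norm ?subr_ge0// ltW.
Unshelve. all: by end_near. Qed.

Let F1 (x : R) : R := 1 - h x.
Let F2 (x : R) : R := L * x + h x.

Let F1_nd : nondecreasing F1.
Proof. by move=> x y xy; rewrite /F1 lerD2l lerN2 h_ni. Qed.

Let F1_rc : right_continuous F1.
Proof.
apply: right_continuousW => x; apply: cvgB; first exact: cvg_cst.
exact: lipschitz_continuous.
Qed.

HB.instance Definition _ := isCumulative.Build R _ R F1 F1_nd F1_rc.

Let F1Ny : F1 @ -oo --> (0 : R).
Proof.
apply: cvg_near_cst; apply: filterS (nbhs_ninfty_le (num_real 0)) => x x0.
by rewrite /F1 h1// subrr.
Qed.

Let F1y : F1 @ +oo --> (1 : R).
Proof.
apply: cvg_near_cst; apply: filterS (nbhs_pinfty_ge (num_real D)) => x x0.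
by rewrite /F1 h0// subr0.
Qed.

HB.instance Definition _ := isCumulativeBounded.Build R 0 1 F1 F1Ny F1y.

Let F2_nd : nondecreasing F2.
Proof. by move=> x y xy; rewrite /F2; have := hL _ _ xy; lra. Qed.

Let F2_rc : right_continuous F2.
Proof.
apply: right_continuousW => x; apply: cvgD; last exact: lipschitz_continuous.
by apply: cvgM; [exact: cvg_cst|exact: cvg_id].
Qed.

HB.instance Definition _ := isCumulative.Build R _ R F2 F2_nd F2_rc.

Let P := lebesgue_stieltjes_measure F1.

Let P_dom : P `<< mu.
Proof.
apply/null_content_dominatesP => A mA muA0.
have Li0 : 0 <= L^-1 by rewrite invr_ge0 ltW.
pose nu := mscale (NngNum Li0)
  (measure_add (lebesgue_stieltjes_measure F1) (lebesgue_stieltjes_measure F2)).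
have nuE B : nu B = (L^-1%:E *
    (lebesgue_stieltjes_measure F1 B + lebesgue_stieltjes_measure F2 B))%E.
  by congr (_ * _)%E; exact: measure_addE.
(* the increments of 1 - h and of L x + h x over ]x, y] sum to L (y - x) *)
have : mu A = nu A.
  apply: lebesgue_measure_unique => // _ [[x y] _ <-].
  rewrite [RHS]nuE.
  have [xy|yx] := leP x y; last first.
    rewrite (_ : [set` _] = set0) ?measure0 ?adde0 ?mule0//.
    by apply/seteqP; split=> z //=; rewrite in_itv/=; lra.
  rewrite !lebesgue_stieltjes_ocitv//= lebesgue_measure_itv/= lte_fin.
  rewrite /F1 /F2 -EFinD -EFinM.
  case: ltP => [_|yx].
    by congr EFin; field; exact: lt0r_neq0.
  have -> : x = y by apply/le_anti; rewrite xy.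
  by congr EFin; lra.
rewrite muA0 nuE => /esym/eqP.
rewrite mule_eq0 eqe invr_eq0 gt_eqF//= padde_eq0 ?measure_ge0//.
by move=> /andP[/eqP].
Qed.

(** A Lipschitz tail function [h] is the tail of a bounded density.  Both [1 - h]
    and [x |-> L * x + h x] are nondecreasing, and the Stieltjes measures of
    the two add up to [L] times Lebesgue measure; hence the first is absolutely
    continuous.  Its Radon-Nikodym density equals minus the derivative of [h]
    almost everywhere, so cutting it at the Lipschitz constant and outside of
    the support changes it on a null set only. *)
Lemma exists_density : exists phi : R -> R,
  [/\ measurable_fun [set: TR] phi, forall x, 0 <= phi x <= L,
      forall x, ~~ (0 < x <= D) -> phi x = 0 &
      forall r : R, 0 <= r -> (\int[mu]_(s in `]r, +oo[) (phi s)%:E = (h r)%:E)%E].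
Proof.
pose psi0 := Radon_Nikodym_SigmaFinite.f (lebesgue_stieltjes_measure F1) mu.
have P_dom' := P_dom.
have psi0_ge0 x : (0 <= psi0 x)%E by apply: Radon_Nikodym_SigmaFinite.f_ge0.
have psi0_fin x : psi0 x \is a fin_num by exact: Radon_Nikodym_SigmaFinite.f_fin_num.
have ipsi0 : mu.-integrable setT psi0 by exact: Radon_Nikodym_SigmaFinite.f_integrable.
have psi0_int A : measurable A -> P A = (\int[mu]_(x in A) psi0 x)%E.
  by move=> mA; exact: Radon_Nikodym_SigmaFinite.f_integral.
pose psi := fine \o psi0.
have psiE : EFin \o psi = psi0 by apply/funext => x /=; rewrite fineK.
have psi_ge0 x : 0 <= psi x by rewrite fine_ge0.
have mpsi : measurable_fun [set: TR] psi.
  by apply/measurable_EFinP; rewrite psiE; exact: measurable_int ipsi0.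
have ipsi : mu.-integrable setT (EFin \o psi) by rewrite psiE.
have tail r : (\int[mu]_(s in `]r, +oo[) (psi s)%:E = (h r)%:E)%E.
  transitivity (P `]r, +oo[%classic).
    by rewrite psi0_int// -psiE.
  (* P ]r, r + k] = h r - h (r + k), which is h r once r + k is beyond D *)
  have cP : (P \o (fun n : nat => `]r, r + n%:R]%classic)) @ \oo --> (h r)%:E.
    apply: cvg_near_cst; near=> n.
    rewrite /= /P lebesgue_stieltjes_ocitv ?lerDl//= /F1 [h (_ + _)]h0; last first.
      rewrite -lerBlDl; near: n; exact: nbhs_infty_ger.
    by congr EFin; rewrite subr0 opprB addrC subrK.
  have cP' : (P \o (fun n : nat => `]r, r + n%:R]%classic)) @ \oo -->
             P `]r, +oo[%classic.
    rewrite itv_bndy_bigcup_BRight; apply: nondecreasing_cvg_mu => //.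
      exact: bigcup_measurable.
    move=> m n mn; apply/subsetPset/subset_itv; rewrite ?bnd_simp//.
    by rewrite lerD2l ler_nat.
  exact: cvg_unique cP' cP.
pose phi x := Num.min (psi x) L * \1_(`]0, D]%classic : set R) x.
have mphi : measurable_fun [set: TR] phi.
  apply: measurable_funM; last exact: measurable_indic.
  by apply: measurable_minr.
have phi_bnd x : 0 <= phi x <= L.
  rewrite /phi indicE; case: (_ \in _); last by rewrite mulr0 lexx ltW.
  by rewrite mulr1 le_min psi_ge0 (ltW L0)/= ge_min lexx orbT.
exists phi; split=> //.
  by move=> x xD; rewrite /phi indicE memNset ?mulr0//= in_itv/=; exact/negP.
move=> r r0; rewrite -tail.
have tail' s : 0 < s -> \int[mu]_(t in `]s, +oo[) psi t = h s.
  by move=> s0; rewrite /Rintegral tail.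
have [N [mN N0 subN]] := derive1_tail_integral h psi ipsi tail'.
(* D itself is put in the null set because h is locally constant only
   strictly beyond D *)
apply: (@integral_off_null _ _ _ _ _ (N `|` [set D])).
- by apply: measurableU => //; exact: measurable_set1.
- have mD : measurable ([set D] : set TR) by exact: measurable_set1.
  rewrite -[RHS]N0; apply: measureU0 => //; exact: lebesgue_measure_set1.
move=> s /=; rewrite in_itv/= andbT => rs sN; congr EFin.
have s0 : 0 < s by exact: le_lt_trans rs.
have [ds dse] : derivable h s 1 /\ derive1 h s = - psi s.
  by apply: contrapT => H; apply: sN; left; apply: subN => /= /(_ s0).
have psiL : psi s <= L.
  by rewrite -lerN2 -dse; exact: derive1_ge_lipschitz.
rewrite /phi (min_idPl psiL) indicE.
have [sD|Ds] := leP s D.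
  by rewrite mem_set ?mulr1//= in_itv/= s0.
rewrite memNset ?mulr0; last by rewrite /= in_itv/= s0/= leNgt Ds.
apply/esym; rewrite -[LHS]opprK -dse -[RHS]oppr0; congr (- _).
rewrite derive1E; have : is_derive s (1 : R) (cst (0 : R)) 0 by exact: is_derive_cst.
move=> /near_eq_is_derive => /(_ h) [|_ ->//].
near=> t; rewrite h0//; apply: ltW; near: t; exact: lt_nbhsr.
Unshelve. all: by end_near. Qed.

End exists_density.
End density.

(** * The Gamma function *)

Section gamma.
Context {R : realType}.
Local Notation TR := (measurableTypeR R).
Local Notation mu := (@lebesgue_measure R).
Local Notation Rpos := (`]0%R, +oo[%classic : set TR).

(** From [1 + u <= expR u] at [u = t / (2 N)], raised to the power [N]; keeping
    half of the exponent leaves an integrable factor against [expR (- t)]. *)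
Lemma powR_le_expR (N : nat) (a t : R) : (0 < N)%N -> 0 <= a <= N%:R -> 0 < t ->
  t `^ a <= (2 * N%:R) ^+ N * expR (2^-1 * t).
Proof.
move=> N0 /andP[a0 aN] t0.
have N0' : (0 : R) < N%:R by rewrite ltr0n.
have t1 : 1 <= 1 + t by rewrite lerDl ltW.
have H : 1 + t <= 2 * N%:R * expR (t / (2 * N%:R)).
  have := expR_ge1Dx (t / (2 * N%:R)).
  rewrite -(@ler_pM2l _ (2 * N%:R)) ?mulr_gt0//; apply: le_trans.
  have -> : 2 * N%:R * (1 + t / (2 * N%:R)) = 2 * N%:R + t.
    by field; rewrite pnatr_eq0 -lt0n.
  rewrite lerD2r.
  have : (1 : R) <= N%:R by rewrite ler1n.
  lra.
apply: (@le_trans _ _ ((1 + t) ^+ N)).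
  apply: (@le_trans _ _ ((1 + t) `^ a)).
    by rewrite ge0_ler_powR// ?nnegrE ?ltW// ?addr_gt0// ltrDr.
  have <- : (1 + t) `^ N%:R = (1 + t) ^+ N by rewrite powR_mulrn// addr_ge0// ltW.
  exact: ler_powR.
apply: (@le_trans _ _ ((2 * N%:R * expR (t / (2 * N%:R))) ^+ N)).
  by rewrite lerXn2r ?nnegrE ?mulr_ge0 ?expR_ge0// addr_ge0// ltW.
rewrite exprMn -expRM_natl ler_wpM2l// ?exprn_ge0// ler_expR.
rewrite le_eqVlt; apply/orP; left; apply/eqP; field.
by rewrite pnatr_eq0 -lt0n.
Qed.

Lemma ln_le_subr1 (x : R) : 0 < x -> ln x <= x - 1.
Proof.
move=> x0; have -> : ln x = ln (1 + (x - 1)) by congr ln; lra.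
by apply: le_ln1Dx; lra.
Qed.

(** For [t > 1], [ln t <= t] costs one more power of [t]; for [t <= 1],
    [- ln t <= t^(-b) / b] costs [b] powers, which [x] can spare.  The bound is
    uniform in [x], as needed to differentiate under the integral. *)
Lemma powR_normr_ln_le (b : R) (N : nat) (x t : R) : 0 < b -> b <= x ->
  x + 1 <= N%:R -> 0 < t ->
  t `^ x * `|ln t| <= (b^-1 + 1) * ((2 * N%:R) ^+ N * expR (2^-1 * t)).
Proof.
move=> b0 bx xN t0.
have N0 : (0 < N)%N by rewrite -(@ltr0n R); lra.
have C1 y : 0 <= y <= N%:R -> t `^ y <= (2 * N%:R) ^+ N * expR (2^-1 * t).
  by move=> yN; exact: powR_le_expR.
have C0 : 0 <= (2 * N%:R) ^+ N * expR (2^-1 * t).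
  by rewrite mulr_ge0 ?exprn_ge0 ?expR_ge0// mulr_ge0.
have bi0 : 0 < b^-1 by rewrite invr_gt0.
have [t1|t1] := leP 1 t.
  rewrite ger0_norm ?ln_ge0//.
  apply: (@le_trans _ _ (t `^ (x + 1))).
    rewrite powRD; last by apply/implyP => _; rewrite gt_eqF.
    rewrite (powRr1 (ltW t0)) ler_wpM2l ?powR_ge0//.
    by have := ln_le_subr1 _ t0; lra.
  apply: (le_trans (C1 _ _)); first by apply/andP; split; lra.
  by rewrite ler_peMl//; lra.
rewrite (ler0_norm (ln_le0 (ltW t1))).
have lnb : - ln t <= b^-1 * t `^ (- b).
  rewrite ler_pdivlMl//.
  by have := ln_le_subr1 _ (powR_gt0 (- b) t0); rewrite ln_powR; lra.
apply: (@le_trans _ _ (b^-1 * t `^ (x - b))).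
  rewrite powRD; last by apply/implyP => _; rewrite gt_eqF.
  by rewrite mulrCA ler_wpM2l ?powR_ge0.
rewrite mulrDl mul1r; apply: (@le_trans _ _ (b^-1 * ((2 * N%:R) ^+ N * expR (2^-1 * t)))).
  rewrite (ler_wpM2l (ltW bi0))// C1//; apply/andP; split; lra.
by rewrite lerDl.
Qed.

Lemma measurable_expRN (D : set TR) :
  measurable_fun D (fun t : TR => expR (- t) : R).
Proof.
by apply: measurable_funTS; apply: measurableT_comp => //; exact: measurableT_comp.
Qed.

Lemma measurable_gamma_integrand (a : R) (D : set TR) :
  measurable_fun D (fun t : TR => (t `^ a * expR (- t))%R : R).
Proof.
apply: measurable_funM; last exact: measurable_expRN.
by apply: measurable_funTS; exact: measurable_powR.
Qed.

Lemma ge0_integralZl_EFin_expRN (c : R) (D : set TR) : measurable D -> 0 <= c ->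
  (c%:E * \int[mu]_(t in D) (expR (- t))%:E =
   \int[mu]_(t in D) (c * expR (- t))%:E)%E.
Proof.
move=> mD c0; rewrite -ge0_integralZl_EFin//.
by apply/measurable_EFinP; exact: measurable_expRN.
Qed.

Lemma integral_expRN_pos : (\int[mu]_(t in Rpos) (expR (- t))%:E = 1)%E.
Proof.
have := ge0_integral_expRN (0 : R); rewrite oppr0 expR0 => <-.
by rewrite -integral_itv_obnd_cbnd//; apply/measurable_EFinP; exact: measurable_expRN.
Qed.

Lemma integrable_expR_half (c : R) : 0 <= c ->
  mu.-integrable Rpos (EFin \o (fun t : R => c * expR (- (2^-1 * t)))).
Proof.
move=> c0; apply/integrableP; split.
  apply/measurable_EFinP; apply: measurable_funTS; apply: measurable_funM => //.
  apply: measurableT_comp => //; apply: measurableT_comp => //.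
under eq_integral do rewrite /= ger0_norm ?mulr_ge0 ?expR_ge0//.
rewrite (@ge0_integral_scale R 2^-1 (fun t => (c * expR (- t))%:E))//.
- by rewrite -ge0_integralZl_EFin_expRN// integral_expRN_pos mule1 -EFinM ltry.
- apply/measurable_EFinP; apply: measurable_funM => //; exact: measurable_expRN.
- by move=> x _; rewrite lee_fin mulr_ge0 ?expR_ge0.
Qed.

Lemma expR_half_mulr (t : R) : expR (2^-1 * t) * expR (- t) = expR (- (2^-1 * t)).
Proof. by rewrite -expRD; congr expR; lra. Qed.

Lemma integrable_gamma (a : R) : 0 <= a ->
  mu.-integrable Rpos (EFin \o (fun t : R => t `^ a * expR (- t))).
Proof.
move=> a0.
pose N := (Num.truncn a).+1.
have aN : a <= N%:R by rewrite ltW// truncnS_gt.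
have C0 : 0 <= (2 * N%:R : R) ^+ N by rewrite exprn_ge0// mulr_ge0.
apply: le_integrable (integrable_expR_half _ C0) => //.
  by apply/measurable_EFinP; exact: measurable_gamma_integrand.
move=> t /=; rewrite in_itv/= andbT => t0; rewrite lee_fin.
rewrite !ger0_norm ?mulr_ge0 ?powR_ge0 ?expR_ge0//.
rewrite -expR_half_mulr mulrA ler_wpM2r ?expR_ge0//.
by apply: powR_le_expR => //; rewrite a0.
Qed.

Lemma EFin_Gamma (a : R) : 0 <= a ->
  (\int[mu]_(t in Rpos) (t `^ a * expR (- t))%:E = (Gamma (1 + a))%:E)%E.
Proof.
move=> a0; rewrite /Gamma /Rintegral fineK.
  by apply: eq_integral => t _; rewrite addrAC subrr add0r.
under eq_integral do rewrite addrAC subrr add0r.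
exact: (integrable_fin_num _ (integrable_gamma _ a0)).
Qed.

Lemma Gamma_tail_ge (a A : R) : 0 <= a -> 0 < A ->
  A `^ a * expR (- A) <= Gamma (1 + a).
Proof.
move=> a0 A0; rewrite -lee_fin -EFin_Gamma//.
have -> : (A `^ a * expR (- A))%:E = (\int[mu]_(t in `[A, +oo[) (A `^ a * expR (- t))%:E)%E.
  by rewrite -ge0_integralZl_EFin_expRN ?powR_ge0// ge0_integral_expRN.
have mG D := @measurable_gamma_integrand a D.
apply: (@le_trans _ _ (\int[mu]_(t in `[A, +oo[) (t `^ a * expR (- t))%:E)%E).
  apply: ge0_le_integral => //.
  - by move=> t _; rewrite lee_fin mulr_ge0 ?powR_ge0 ?expR_ge0.
  - apply/measurable_EFinP; apply: measurable_funM => //; exact: measurable_expRN.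
  - exact/measurable_EFinP.
  - move=> t /=; rewrite in_itv/= andbT => tA; rewrite lee_fin ler_wpM2r ?expR_ge0//.
    by rewrite ge0_ler_powR// nnegrE ltW// (lt_le_trans A0).
apply: ge0_subset_integral => //.
- exact/measurable_EFinP.
- by move=> t _; rewrite lee_fin mulr_ge0 ?powR_ge0 ?expR_ge0.
- by move=> t /=; rewrite !in_itv/= !andbT; exact: lt_le_trans.
Qed.

Lemma Gamma_gt0 (a : R) : 0 <= a -> 0 < Gamma (1 + a).
Proof.
move=> a0; apply: lt_le_trans (Gamma_tail_ge _ _ a0 ltr01).
by rewrite mulr_gt0 ?powR_gt0 ?expR_gt0.
Qed.

(** [Gamma (1 + (n + p) / 2)] is negligible with respect to [Gamma (1 + p)] at the
    scale of [p]-th roots.  Split the integral at [t = A]: below, [t] is at most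
    [A], and [A^p] is at most [expR A * Gamma (1 + p)]; above,
    [t^((n + p) / 2) = t^p * t^((n - p) / 2)] with a nonpositive last
    exponent. *)
Lemma Gamma_half_le (n p A : R) : 0 <= n -> n <= p -> 0 < A ->
  Gamma (1 + (n + p) / 2) <= A `^ ((n - p) / 2) * (expR A + 1) * Gamma (1 + p).
Proof.
move=> n0 np A0.
have p0 : 0 <= p by lra.
have npE : (n + p) / 2 = p + (n - p) / 2 by lra.
have np0 : 0 <= (n + p) / 2 by lra.
set c := A `^ ((n - p) / 2).
have c0 : 0 < c by exact: powR_gt0.
have mg a D := measurable_gamma_integrand a D.
have mE D := measurable_expRN D.
have ApE : A `^ p <= expR A * Gamma (1 + p).
  rewrite mulrC -ler_pdivrMr ?expR_gt0// -expRN.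
  exact: Gamma_tail_ge.
have splitA q r : A `^ (q + r) = A `^ q * A `^ r.
  by rewrite powRD//; apply/implyP => _; rewrite gt_eqF.
have H : Gamma (1 + (n + p) / 2) <= A `^ ((n + p) / 2) + c * Gamma (1 + p).
  rewrite -lee_fin EFinD EFinM -(EFin_Gamma _ np0) -(EFin_Gamma _ p0).
  rewrite -[X in (_ <= X + _)%E]mule1 -integral_expRN_pos.
  rewrite ge0_integralZl_EFin_expRN ?powR_ge0//.
  have -> : (c%:E * \int[mu]_(t in Rpos) (t `^ p * expR (- t))%:E =
             \int[mu]_(t in Rpos) (c * (t `^ p * expR (- t)))%:E)%E.
    rewrite -ge0_integralZl_EFin ?powR_ge0//.
    - by move=> x _; rewrite lee_fin mulr_ge0 ?powR_ge0 ?expR_ge0.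
    - exact/measurable_EFinP.
  rewrite -ge0_integralD//.
  - apply: ge0_le_integral => //.
    + by move=> x _; rewrite lee_fin mulr_ge0 ?powR_ge0 ?expR_ge0.
    + exact/measurable_EFinP.
    + by apply/measurable_EFinP; apply: measurable_funD; apply: measurable_funM.
    move=> t /=; rewrite in_itv/= andbT => t0; rewrite -EFinD lee_fin.
    rewrite mulrA -mulrDl ler_wpM2r ?expR_ge0//.
    have [tA|At] := leP t A.
      rewrite (@le_trans _ _ (A `^ ((n + p) / 2)))//.
        by rewrite ge0_ler_powR// nnegrE ltW.
      by rewrite lerDl mulr_ge0 ?powR_ge0.
    rewrite (@le_trans _ _ (c * t `^ p))//; last by rewrite lerDr powR_ge0.
    have -> : t `^ ((n + p) / 2) = t `^ ((n - p) / 2) * t `^ p.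
      by rewrite -powRD; [congr powR; lra|apply/implyP => _; rewrite gt_eqF].
    rewrite ler_wpM2r ?powR_ge0// /c.
    have -> : (n - p) / 2 = - ((p - n) / 2) by lra.
    rewrite !powRN lef_pV2 ?posrE ?powR_gt0//.
    apply: ge0_ler_powR; rewrite ?nnegrE; [by lra|exact: ltW|exact: ltW|exact: ltW].
  - by move=> x _; rewrite lee_fin mulr_ge0 ?powR_ge0 ?expR_ge0.
  - by apply/measurable_EFinP; apply: measurable_funM.
  - by move=> x _; rewrite lee_fin !mulr_ge0 ?powR_ge0 ?expR_ge0.
  - by apply/measurable_EFinP; apply: measurable_funM.
apply: (le_trans H).
have -> : A `^ ((n + p) / 2) = A `^ p * c.
  by rewrite npE splitA.
have -> : c * (expR A + 1) * Gamma (1 + p) =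
          expR A * Gamma (1 + p) * c + c * Gamma (1 + p) by ring.
by rewrite lerD2r ler_wpM2r// ltW.
Qed.

(** Differentiation under the integral, dominated on the parameters between
    [1 + a / 2] and [a + 2]. *)
Lemma derive1_Gamma (a : R) : 0 < a ->
  derive1 Gamma (1 + a) = \int[mu]_(t in Rpos) (t `^ a * ln t * expR (- t)).
Proof.
move=> a0.
pose f (z t : R) : R := t `^ (z - 1) * expR (- t).
pose b := a / 2.
have b0 : 0 < b by rewrite divr_gt0.
pose N := (Num.truncn (a + 2)).+1.
have aN : a + 2 < N%:R by exact: truncnS_gt.
pose G (t : R) : R := (b^-1 + 1) * (2 * N%:R) ^+ N * expR (- (2^-1 * t)).
have C0 : 0 <= (b^-1 + 1) * (2 * N%:R) ^+ N.
  by rewrite mulr_ge0 ?exprn_ge0 ?mulr_ge0// addr_ge0// invr_ge0 ltW.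
have dft z t : 0 < t -> is_derive z (1 : R) (f ^~ t) (t `^ (z - 1) * ln t * expR (- t)).
  move=> t0.
  have -> : f ^~ t = (expR \o (cst (ln t) * (id - cst 1))) * cst (expR (- t)).
    apply/funext => y; rewrite /f /= /powR gt_eqF//.
    by congr (expR _ * _); rewrite mulrC.
  have -> : t `^ (z - 1) = expR (ln t * (z - 1)) by rewrite /powR gt_eqF// mulrC.
  apply: is_derive_eq.
  rewrite !scaler0 add0r addr0 subr0 /= /cst /GRing.scale/= mulr1.
  by rewrite mulrC -mulrA.
have Ia : `]1 + b, a + 2[%classic (1 + a).
  by rewrite /= in_itv/= /b; apply/andP; split; lra.
have intf z : `]1 + b, a + 2[%classic z -> mu.-integrable Rpos (EFin \o f z).
  rewrite /= in_itv/= => /andP[bz _]; apply: integrable_gamma; lra.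
have derf z t : `]1 + b, a + 2[%classic z -> Rpos t -> derivable (f ^~ t) z 1.
  by rewrite /= => _; rewrite in_itv/= andbT => /(dft z)[].
have d1f z t : 0 < t -> partial1of2 f z t = t `^ (z - 1) * ln t * expR (- t).
  by move=> t0; rewrite partial1of2E; case: (dft z t t0).
have G_ub z t : `]1 + b, a + 2[%classic z -> Rpos t -> `|partial1of2 f z t| <= G t.
  rewrite /= !in_itv/= andbT => /andP[bz za] t0; rewrite d1f// !normrM.
  rewrite (ger0_norm (powR_ge0 _ _)) (ger0_norm (expR_ge0 _)).
  rewrite /G -expR_half_mulr mulrA ler_wpM2r ?expR_ge0// -mulrA.
  by apply: powR_normr_ln_le => //; lra.
have G0 t : 0 <= G t by rewrite mulr_ge0 ?expR_ge0.
have iG : mu.-integrable Rpos (EFin \o G) by exact: integrable_expR_half.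
have mRpos : measurable Rpos by exact: measurable_itv.
have GammaE : Gamma = (fun z => \int[mu]_(t in Rpos) f z t) by [].
rewrite GammaE.
rewrite (@differentiation_under_integral R _ TR mu f Rpos mRpos _ _ _ Ia intf derf G G0 iG G_ub).
apply: eq_Rintegral => t; rewrite inE/= in_itv/= andbT => t0.
by rewrite d1f// addrAC subrr add0r.
Qed.

Lemma integrable_gamma_ln (a : R) : 0 < a ->
  mu.-integrable Rpos (EFin \o (fun t : R => t `^ a * ln t * expR (- t))).
Proof.
move=> a0.
pose N := (Num.truncn (a + 2)).+1.
have aN : a + 2 < N%:R by exact: truncnS_gt.
have C0 : 0 <= (a^-1 + 1) * (2 * N%:R) ^+ N.
  by rewrite mulr_ge0 ?exprn_ge0 ?mulr_ge0// addr_ge0// invr_ge0 ltW.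
apply: le_integrable (integrable_expR_half _ C0) => //.
  apply/measurable_EFinP; apply: measurable_funM; last exact: measurable_expRN.
  by apply: measurable_funTS; apply: measurable_funM.
move=> t /=; rewrite in_itv/= andbT => t0; rewrite lee_fin.
rewrite !normrM (ger0_norm (powR_ge0 _ _)) !(ger0_norm (expR_ge0 _)).
rewrite -[X in _ <= X * _]normrM (ger0_norm C0).
rewrite -expR_half_mulr mulrA ler_wpM2r ?expR_ge0// -mulrA.
by apply: powR_normr_ln_le => //; lra.
Qed.

End gamma.

(** * Iterated integrals over subsets, and the logarithm against a density *)

Section fubini_in.
Context {R : realType} d1 d2 (T1 : measurableType d1) (T2 : measurableType d2).
Variables (m1 : {sigma_finite_measure set T1 -> \bar R}).
Variables (m2 : {sigma_finite_measure set T2 -> \bar R}).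
Variables (D1 : set T1) (D2 : set T2).
Hypotheses (mD1 : measurable D1) (mD2 : measurable D2).

Lemma integral_restrict_setX1 (f : T1 * T2 -> \bar R) :
  (\int[m1]_(x in D1) \int[m2]_(y in D2) f (x, y) =
   \int[m1]_x \int[m2]_y (f \_ (D1 `*` D2)) (x, y))%E.
Proof.
rewrite integral_mkcond; apply: eq_integral => x _; rewrite patchE.
case: ifPn => xD1.
  rewrite integral_mkcond; apply: eq_integral => y _; rewrite !patchE.
  by rewrite in_setX/= xD1.
by rewrite integral0_eq// => y _; rewrite patchE in_setX/= (negPf xD1).
Qed.

Lemma integral_restrict_setX2 (f : T1 * T2 -> \bar R) :
  (\int[m2]_(y in D2) \int[m1]_(x in D1) f (x, y) =
   \int[m2]_y \int[m1]_x (f \_ (D1 `*` D2)) (x, y))%E.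
Proof.
rewrite integral_mkcond; apply: eq_integral => y _; rewrite patchE.
case: ifPn => yD2.
  rewrite integral_mkcond; apply: eq_integral => x _; rewrite !patchE.
  by rewrite in_setX/= yD2 andbT.
by rewrite integral0_eq// => x _; rewrite patchE in_setX/= (negPf yD2) andbF.
Qed.

Let measurable_restrict_setX (f : T1 * T2 -> \bar R) : measurable_fun setT f ->
  measurable_fun setT (f \_ (D1 `*` D2)).
Proof.
move=> mf; apply/(measurable_restrictT _ _).1; first exact: measurableX.
exact: measurable_funTS.
Qed.

Lemma fubini_tonelli_in (f : T1 * T2 -> \bar R) :
  measurable_fun setT f -> (forall z, 0 <= f z)%E ->
  (\int[m1]_(x in D1) \int[m2]_(y in D2) f (x, y) =
   \int[m2]_(y in D2) \int[m1]_(x in D1) f (x, y))%E.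
Proof.
move=> mf f0; rewrite integral_restrict_setX1 integral_restrict_setX2.
apply: fubini_tonelli; first exact: measurable_restrict_setX.
by move=> z; exact: erestrict_ge0.
Qed.

Lemma measurable_fubini_tonelli_in1 (f : T1 * T2 -> \bar R) :
  measurable_fun setT f -> (forall z, 0 <= f z)%E ->
  measurable_fun D1 (fun x => \int[m2]_(y in D2) f (x, y))%E.
Proof.
move=> mf f0.
have mF := @measurable_fun_fubini_tonelli_F _ _ T1 T2 R m2 _
  (measurable_restrict_setX _ mf).
have {}mF := measurable_funTS (D := D1) (mF (fun z => erestrict_ge0 (fun z _ => f0 z) z)).
apply: eq_measurable_fun mF => x xD1.
rewrite /fubini_F [RHS]integral_mkcond; apply: eq_integral => y _; rewrite !patchE.
by rewrite in_setX/= xD1.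
Qed.

Lemma Fubini_in (f : T1 * T2 -> \bar R) : measurable_fun setT f ->
  (\int[m2]_(y in D2) \int[m1]_(x in D1) `|f (x, y)| < +oo)%E ->
  (\int[m1]_(x in D1) \int[m2]_(y in D2) f (x, y) =
   \int[m2]_(y in D2) \int[m1]_(x in D1) f (x, y))%E.
Proof.
move=> mf intf; rewrite integral_restrict_setX1 integral_restrict_setX2.
apply: Fubini; apply/integrable21ltyP; first exact: measurable_restrict_setX.
move: intf; rewrite (integral_restrict_setX2 (abse \o f)); apply: le_lt_trans.
rewrite le_eqVlt; apply/orP; left; apply/eqP; apply: eq_integral => y _.
apply: eq_integral => x _; rewrite !patchE/=.
by case: ifPn => // _; rewrite abse0.
Qed.

End fubini_in.

Section log_integrals.
Context {R : realType}.
Local Notation TR := (measurableTypeR R).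
Local Notation mu := (@lebesgue_measure R).
Local Notation Rpos := (`]0%R, +oo[%classic : set TR).

(** Area of [{(u, t) | 0 < u <= expR (- t), 0 < t}], computed in both orders. *)
Lemma integral_ln_itv01 :
  (\int[mu]_(u in Rpos) ((u <= 1)%R%:R * - ln u)%:E = 1)%E.
Proof.
pose f (z : TR * TR) : \bar R := (\1_(`]-oo, 0%R]%classic : set TR) (z.1 - expR (- z.2)))%:E.
have mf : measurable_fun setT f.
  apply/measurable_EFinP; apply: measurableT_comp => //.
  apply: measurable_funB; first exact: measurable_fst.
  by apply: measurableT_comp => //; apply: measurableT_comp.
have f0 z : (0 <= f z)%E by rewrite lee_fin.
have fE u t : f (u, t) = ((u <= expR (- t))%R%:R)%:E.
  by rewrite /f /= indicE mem_setE in_itv/= subr_le0.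
have mRpos : measurable Rpos by exact: measurable_itv.
have len a : 0 <= a -> (\int[mu]_(t in Rpos) ((t <= a)%R%:R)%:E = a%:E)%E.
  move=> a0.
  have -> : (\int[mu]_(t in Rpos) ((t <= a)%R%:R)%:E =
             \int[mu]_(t in Rpos) (\1_(`]-oo, a]%classic : set TR) t)%:E)%E.
    by apply: eq_integral => t _; rewrite indicE mem_setE in_itv.
  rewrite integral_indic//.
  have -> : (`]-oo, a] `&` Rpos = `]0, a])%classic.
    by apply/seteqP; split=> t /=; rewrite !in_itv/= andbT; [move=> [-> ->]|move=> /andP[]].
  apply: (etrans (lebesgue_measure_itv `]0, a])); rewrite /= lte_fin; case: ltP => [_|a0']; first by rewrite sube0.
  by congr EFin; apply/le_anti; rewrite a0 a0'.
transitivity (\int[mu]_(x in Rpos) \int[mu]_(y in Rpos) f (x, y))%E.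
  apply: eq_integral => u; rewrite inE/= in_itv/= andbT => u0.
  have H t : (u <= expR (- t)) = (t <= - ln u).
    by rewrite -[in LHS](lnK u0) ler_expR lerNr.
  have [u1|u1] := leP (u : R) 1.
    have l0 : 0 <= - ln u by rewrite oppr_ge0 ln_le0.
    rewrite mul1r -(len _ l0); apply: eq_integral => t _.
    by rewrite fE H.
  apply: esym; rewrite mul0r; apply: integral0_eq => t; rewrite /= in_itv/= andbT => t0.
  have nt : (t <= - ln u) = false.
    by apply/negbTE; rewrite -ltNge (lt_trans _ t0)// oppr_lt0 ln_gt0.
  by rewrite fE H nt.
rewrite (@fubini_tonelli_in R _ _ TR TR mu mu Rpos Rpos mRpos mRpos f mf f0).
rewrite -integral_expRN_pos; apply: eq_integral => t _.
rewrite -(len _ (expR_ge0 (- t))); apply: eq_integral => u _.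
by rewrite fE.
Qed.

(** Near 0 the logarithm is integrable and [phi] is bounded; between 1 and [D]
    the logarithm is bounded and [phi] is integrable. *)
Lemma integrable_density_ln (phi : R -> R) (L D : R) :
  measurable_fun [set: TR] phi -> (forall x, 0 <= phi x <= L) ->
  (forall x, ~~ (0 < x <= D) -> phi x = 0) ->
  mu.-integrable Rpos (EFin \o phi) ->
  mu.-integrable Rpos (EFin \o (fun x => phi x * ln x)).
Proof.
move=> mphi phi_bnd phiD iphi.
have L0 : 0 <= L by have /andP[] := phi_bnd 0; exact: le_trans.
have mRpos : measurable Rpos by exact: measurable_itv.
have mind : measurable_fun Rpos (fun u : TR => ((u <= 1)%R%:R * - ln u) : R).
  apply: measurable_funTS; apply: measurable_funM; last exact: measurableT_comp.
  have -> : (fun u : TR => (u <= 1)%R%:R : R) = \1_(`]-oo, 1%R]%classic : set TR).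
    by apply/funext => u; rewrite indicE mem_setE in_itv.
  exact: measurable_indic.
have i1 : mu.-integrable Rpos (EFin \o (fun u : R => (u <= 1)%R%:R * - ln u)).
  apply/integrableP; split; first exact/measurable_EFinP.
  rewrite (_ : (\int[mu]_(x in Rpos) _ = 1)%E) ?ltry// -integral_ln_itv01.
  apply: eq_integral => u _; rewrite /= ger0_norm//.
  have [u1|u1] := leP (u : R) 1; last by rewrite mul0r.
  by rewrite mul1r oppr_ge0 ln_le0.
pose M := `|ln D|.
pose j (u : R) : R := (u <= 1)%R%:R * - ln u.
have i2 : mu.-integrable Rpos (EFin \o (fun u : R => L * j u + M * phi u)).
  have -> : EFin \o (fun u : R => L * j u + M * phi u) =
     (fun u => L%:E * (EFin \o j) u)%E \+ (fun u => M%:E * (EFin \o phi) u)%E.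
    by apply/funext => u /=.
  by apply: integrableD => //; apply: integrableZl.
apply: le_integrable i2 => //.
  apply/measurable_EFinP; apply: measurable_funTS; exact: measurable_funM.
move=> u /=; rewrite in_itv/= andbT => u0; rewrite lee_fin.
have /andP[p0 pL] := phi_bnd u.
have M0 : 0 <= M by exact: normr_ge0.
rewrite /j.
rewrite normrM (ger0_norm p0); have [u1|u1] := leP (u : R) 1.
  rewrite mul1r ler0_norm ?ln_le0//.
  have l0 : 0 <= - ln u by rewrite oppr_ge0 ln_le0.
  rewrite ger0_norm; last by rewrite addr_ge0 ?mulr_ge0.
  apply: (@le_trans _ _ (L * - ln u)); first by rewrite ler_wpM2r.
  by rewrite lerDl mulr_ge0.
rewrite mul0r mulr0 add0r (ger0_norm (mulr_ge0 M0 p0)) mulrC.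
have [uD|Du] := leP (u : R) D; last by rewrite phiD ?mulr0// negb_and -ltNge Du orbT.
rewrite ler_wpM2r// /M !ger0_norm ?ln_ge0 ?(ltW u1)//.
  by rewrite ler_ln// posrE// (lt_le_trans u0).
by rewrite (le_trans (ltW u1)).
Qed.

End log_integrals.

(** * Mixtures over a Gamma-distributed scale *)

Section gamma_mixture.
Context {R : realType}.
Local Notation TR := (measurableTypeR R).
Local Notation mu := (@lebesgue_measure R).
Local Notation Rpos := (`]0%R, +oo[%classic : set TR).

(** The square root of [2 * s], as a power: its powers and logarithm then follow
    from the laws of [powR].  It is the value of the gauge at which the
    Gaussian is [expR (- s)]. *)
Definition tau (s : R) : R := (2 * s) `^ 2^-1.

Lemma tau_gt0 (s : R) : 0 < s -> 0 < tau s.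
Proof. by move=> s0; rewrite powR_gt0// mulr_gt0. Qed.

Lemma tau_powR (s q : R) : 0 < s -> tau s `^ q = 2 `^ (q / 2) * s `^ (q / 2).
Proof. by move=> s0; rewrite /tau -powRrM [2^-1 * q]mulrC powRM// ltW. Qed.

Lemma ln_tau (s : R) : 0 < s -> ln (tau s) = (ln 2 + ln s) / 2.
Proof. by move=> s0; rewrite /tau ln_powR lnM ?posrE// mulrC. Qed.

Lemma measurable_tauV : measurable_fun [set: TR] (fun s : TR => (tau s)^-1 : R).
Proof.
have -> : (fun s : TR => (tau s)^-1 : R) = (@powR R ^~ (- 2^-1)) \o (fun s : TR => 2 * s).
  by apply/funext => s /=; rewrite powRN.
by apply: measurableT_comp; [exact: measurable_powR|exact: measurable_funM].
Qed.

Lemma measurable_div_tau : measurable_fun [set: TR * TR] (fun z => z.1 / tau z.2 : R).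
Proof.
apply: measurable_funM; first exact: measurable_fst.
exact: (measurableT_comp measurable_tauV measurable_snd).
Qed.

Lemma Rpos_gt0 (x : TR) : Rpos x -> 0 < (x : R).
Proof. by rewrite /= in_itv/= andbT. Qed.

Lemma integral_scale (c : R) (f : TR -> \bar R) : 0 < c -> mu.-integrable Rpos f ->
  (\int[mu]_(x in Rpos) f (c * x)%R = c^-1%:E * \int[mu]_(x in Rpos) f x)%E.
Proof.
move=> c0 intf.
have mf := measurable_int _ intf.
rewrite integralE [in RHS]integralE muleBr//; last first.
  by apply: fin_num_adde_defr; exact: integrable_pos_fin_num.
rewrite -!ge0_integral_scale//.
- congr (_ - _)%E; apply: eq_integral => x _; first by rewrite !funeposE.
  by rewrite !funenegE.
- exact: measurable_funeneg.
- exact: measurable_funepos.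
Qed.

(** Outside of a null set the tail has a derivative, which is [- phi]. *)
Lemma log_moment_derive1 (h phi : R -> R) :
  mu.-integrable setT (EFin \o phi) ->
  (forall r : R, 0 < r -> (\int[mu]_(s in `]r, +oo[) (phi s)%:E = (h r)%:E)%E) ->
  \int[mu]_(r in Rpos) (- derive1 h r * ln r) = \int[mu]_(r in Rpos) (phi r * ln r).
Proof.
move=> iphi hE.
have hE' r : 0 < r -> \int[mu]_(s in `]r, +oo[) phi s = h r.
  by move=> r0; rewrite /Rintegral hE.
have [N [mN N0 subN]] := derive1_tail_integral h phi iphi hE'.
rewrite /Rintegral; congr fine; apply: (@integral_off_null _ _ _ _ _ N) => //.
move=> r /Rpos_gt0 r0 rN.
have [_ ->] : derivable h r 1 /\ derive1 h r = - phi r; last by rewrite opprK.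
by apply: contrapT => K; apply: rN; apply: subN => /= /(_ r0).
Qed.

(** The [p]-th moment of a product of independent variables, the first being
    [tau s] for [s] of a Gamma law: exchange the integrals and rescale the inner
    one by [r = tau s * u]. *)
Lemma gamma_mixture_moment (k : R -> R) (q p : R) : 0 <= q -> 0 < p ->
  measurable_fun [set: TR] k -> (forall u, 0 <= k u) ->
  (\int[mu]_(r in Rpos) (\int[mu]_(s in Rpos)
      (expR (- s) * tau s `^ q * k (r / tau s) * r `^ (p - 1))%:E) =
   (2 `^ ((q + p) / 2) * Gamma (1 + (q + p) / 2))%:E *
     \int[mu]_(u in Rpos) (k u * u `^ (p - 1))%:E)%E.
Proof.
move=> q0 p0 mk k0.
pose f (z : TR * TR) : \bar R :=
  (expR (- z.2) * tau z.2 `^ q * k (z.1 / tau z.2) * z.1 `^ (p - 1))%:E.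
have mtau : measurable_fun [set: TR] (fun s : TR => tau s `^ q : R).
  apply: (measurableT_comp (measurable_powR q)).
  by apply: (measurableT_comp (measurable_powR _)); exact: measurable_funM.
have mf : measurable_fun setT f.
  apply/measurable_EFinP; apply: measurable_funM; last first.
    by apply: (measurableT_comp (measurable_powR _)); exact: measurable_fst.
  apply: measurable_funM; last exact: (measurableT_comp mk measurable_div_tau).
  apply: measurable_funM; last exact: (measurableT_comp mtau measurable_snd).
  apply: (measurableT_comp (measurable_expRN setT)); exact: measurable_snd.
have f0 z : (0 <= f z)%E.
  by rewrite lee_fin !mulr_ge0 ?expR_ge0 ?powR_ge0.
have mRpos : measurable Rpos by exact: measurable_itv.
rewrite (@fubini_tonelli_in R _ _ TR TR mu mu Rpos Rpos mRpos mRpos f mf f0).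
set I := (\int[mu]_(u in Rpos) (k u * u `^ (p - 1))%:E)%E.
have I0 : (0 <= I)%E.
  by apply: integral_ge0 => u _; rewrite lee_fin mulr_ge0 ?powR_ge0.
have mkp (c : R) : measurable_fun Rpos (fun u : TR => (k u * (c * u) `^ (p - 1))%:E).
  apply/measurable_EFinP; apply: measurable_funTS; apply: measurable_funM => //.
  by apply: (measurableT_comp (measurable_powR _)); exact: measurable_funM.
have inner s : Rpos s -> (\int[mu]_(r in Rpos) f (r, s) =
    (2 `^ ((q + p) / 2) * (s `^ ((q + p) / 2) * expR (- s)))%:E * I)%E.
  move=> /Rpos_gt0 s0; have t0 := tau_gt0 s s0.
  pose F (u : TR) : \bar R := ((expR (- s) * tau s `^ q)%:E * (k u * (tau s * u) `^ (p - 1))%:E)%E.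
  have -> : (\int[mu]_(r in Rpos) f (r, s) = \int[mu]_(r in Rpos) F ((tau s)^-1 * r)%R)%E.
    apply: eq_integral => r _; rewrite /f /F/= -EFinM; congr EFin.
    rewrite mulrA; congr (_ * _ * _ `^ _); first by rewrite mulrC.
    by rewrite mulrA mulfV ?mul1r// gt_eqF.
  have ti0 : 0 < (tau s)^-1 by rewrite invr_gt0.
  rewrite (@ge0_integral_scale R _ F ti0); last 2 first.
  - by apply: measurable_funeM; exact: mkp.
  - by move=> u u0; rewrite /F mule_ge0// lee_fin ?mulr_ge0 ?expR_ge0 ?powR_ge0.
  rewrite invrK /F ge0_integralZl_EFin//; last 2 first.
  - by move=> u _; rewrite lee_fin mulr_ge0 ?powR_ge0.
  - by rewrite mulr_ge0 ?expR_ge0 ?powR_ge0.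
  have -> : (\int[mu]_(u in Rpos) (k u * (tau s * u) `^ (p - 1))%:E =
             (tau s `^ (p - 1))%:E * I)%E.
    rewrite /I -ge0_integralZl_EFin ?powR_ge0//; last 2 first.
    - by move=> u _; rewrite lee_fin mulr_ge0 ?powR_ge0.
    - apply/measurable_EFinP; apply: measurable_funTS.
      apply: measurable_funM => //; exact: measurable_powR.
    apply: eq_integral => u; rewrite inE => /Rpos_gt0 u0.
    by rewrite -EFinM powRM ?ltW//; congr EFin; ring.
  rewrite !muleA -!EFinM; congr (_%:E * _)%E.
  have -> : tau s * (expR (- s) * tau s `^ q) * tau s `^ (p - 1) =
            tau s `^ (q + p) * expR (- s).
    have -> : q + p = 1 + q + (p - 1) by ring.
    rewrite !powRD; try by apply/implyP => _; rewrite gt_eqF.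
    by rewrite powRr1 ?ltW//; ring.
  by rewrite tau_powR// mulrA.
under eq_integral => s sR.
  rewrite inner; last exact: set_mem.
  over.
rewrite ge0_integralZr//; last 2 first.
- apply/measurable_EFinP; apply: measurable_funM => //; exact: measurable_gamma_integrand.
- by move=> s _; rewrite lee_fin !mulr_ge0 ?expR_ge0 ?powR_ge0.
congr (_ * _)%E; rewrite EFinM -EFin_Gamma ?divr_ge0 ?addr_ge0 ?(ltW p0)//.
rewrite -ge0_integralZl_EFin ?powR_ge0//.
- by move=> s _; rewrite lee_fin !mulr_ge0 ?expR_ge0 ?powR_ge0.
- by apply/measurable_EFinP; exact: measurable_gamma_integrand.
Qed.

(** In probabilistic terms: [h] is the tail of a positive random variable [X], and
    [H] the tail of [tau S * X], for [S] independent of [X] with a Gamma law of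
    parameter [1 + a], whose density is [w].  The expectations of the logarithms
    of [X] and of [tau S] add up. *)
Section log_mixture.
Variables (a L D : R) (h H : R -> R).
Hypothesis a_ge : 2^-1 <= a.
Let w (s : R) : R := s `^ a * expR (- s) / Gamma (1 + a).
Hypothesis HE : forall r, 0 <= r ->
  (\int[mu]_(s in Rpos) (w s * h (r / tau s))%:E = (H r)%:E)%E.

Let a0 : 0 < a. Proof. by apply: lt_le_trans a_ge. Qed.

Let G0 : 0 < Gamma (1 + a). Proof. by apply: Gamma_gt0; exact: ltW. Qed.

Let w0 s : 0 <= w s.
Proof. by rewrite /w !mulr_ge0 ?powR_ge0 ?expR_ge0// invr_ge0 ltW. Qed.

Let mw : measurable_fun [set: TR] w.
Proof. by apply: measurable_funM => //; exact: measurable_gamma_integrand. Qed.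

Let integrable_w : mu.-integrable Rpos (EFin \o w).
Proof.
have -> : EFin \o w = fun s => ((Gamma (1 + a))^-1%:E *
    (EFin \o (fun t : R => (t `^ a * expR (- t))%R)) s)%E.
  by apply/funext => s; rewrite /w /= -EFinM mulrC.
by apply: integrableZl => //; apply: integrable_gamma; exact: ltW.
Qed.

Let integral_w : (\int[mu]_(s in Rpos) (w s)%:E = 1)%E.
Proof.
have -> : (\int[mu]_(s in Rpos) (w s)%:E = (Gamma (1 + a))^-1%:E *
    \int[mu]_(s in Rpos) (s `^ a * expR (- s))%:E)%E.
  rewrite -integralZl//; last by apply: integrable_gamma; exact: ltW.
  by apply: eq_integral => s _; rewrite /w -EFinM mulrC.
by rewrite EFin_Gamma ?ltW// -EFinM mulVf// gt_eqF.
Qed.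

Let integrable_w_ln : mu.-integrable Rpos (EFin \o (fun s => w s * ln (tau s))).
Proof.
pose g (t : R) := t `^ a * ln t * expR (- t).
have i1 : mu.-integrable Rpos (EFin \o g) by exact: integrable_gamma_ln.
have i2 : mu.-integrable Rpos
    ((fun s => (ln 2 / 2)%:E * (EFin \o w) s)%E \+
     (fun s => ((Gamma (1 + a))^-1 / 2)%:E * (EFin \o g) s)%E)%E.
  by apply: integrableD => //; apply: integrableZl.
apply: eq_integrable i2 => // s; rewrite inE => /Rpos_gt0 s0.
rewrite /= -!EFinM -EFinD ln_tau//; congr EFin; rewrite /w /g; ring.
Qed.

Let integral_w_ln : \int[mu]_(s in Rpos) (w s * ln (tau s)) =
  2^-1 * (ln 2 + digamma (1 + a)).
Proof.
pose g (t : R) := t `^ a * ln t * expR (- t).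
have i1 : mu.-integrable Rpos (EFin \o g) by exact: integrable_gamma_ln.
transitivity (\int[mu]_(s in Rpos) (ln 2 / 2 * w s + (Gamma (1 + a))^-1 / 2 * g s)).
  apply: eq_Rintegral => s; rewrite inE => /Rpos_gt0 s0.
  by rewrite ln_tau// /w /g; ring.
rewrite RintegralD//; last 2 first.
- by apply: eq_integrable (integrableZl _ (ln 2 / 2) integrable_w).
- by apply: eq_integrable (integrableZl _ ((Gamma (1 + a))^-1 / 2) i1).
rewrite !RintegralZl// {1}/Rintegral integral_w/= mulr1.
have dG := derive1_Gamma _ a0.
rewrite /digamma dG; field.
exact: lt0r_neq0.
Qed.

Variable phi : R -> R.
Hypotheses (mphi : measurable_fun [set: TR] phi)
  (phi_bnd : forall x, 0 <= phi x <= L)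
  (phiD : forall x, ~~ (0 < x <= D) -> phi x = 0)
  (h00 : h 0 = 1)
  (tail : forall r : R, 0 <= r ->
     (\int[mu]_(s in `]r, +oo[) (phi s)%:E = (h r)%:E)%E).

Let phi_ge0 x : 0 <= phi x. Proof. by have /andP[] := phi_bnd x. Qed.

Let phi_le x : phi x <= L. Proof. by have /andP[] := phi_bnd x. Qed.

Let mRpos : measurable Rpos. Proof. exact: measurable_itv. Qed.

Let integral_phi : (\int[mu]_(u in Rpos) (phi u)%:E = 1)%E.
Proof. by rewrite tail// h00. Qed.

Let integrable_phi : mu.-integrable Rpos (EFin \o phi).
Proof.
apply/integrableP; split; first by apply/measurable_EFinP; exact: measurable_funTS.
under eq_integral do rewrite /= ger0_norm ?phi_ge0//.
by rewrite integral_phi ltry.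
Qed.

Let phi_np x : x <= 0 -> phi x = 0.
Proof. by move=> x0; rewrite phiD// negb_and -leNgt x0. Qed.

(** The joint density of [tau S * X] and [S]. *)
Let f0 (z : TR * TR) : R := w z.2 * ((tau z.2)^-1 * phi (z.1 / tau z.2)).

Let mf0 : measurable_fun setT f0.
Proof.
apply: measurable_funM; first exact: (measurableT_comp mw measurable_snd).
apply: measurable_funM; first exact: (measurableT_comp measurable_tauV measurable_snd).
exact: (measurableT_comp mphi measurable_div_tau).
Qed.

Let f0_ge0 z : 0 <= f0 z.
Proof.
apply: mulr_ge0; first exact: w0.
by apply: mulr_ge0; [rewrite invr_ge0; exact: powR_ge0|exact: phi_ge0].
Qed.

(** The factor [1 / tau s] is of order [s^(-1/2)] near 0; it is absorbed by [s^a]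
    because [a] is at least [1 / 2]. *)
Let integrable_f0 r : mu.-integrable Rpos (fun s => (f0 (r, s))%:E).
Proof.
have ia : 0 <= a - 2^-1 by rewrite subr_ge0.
have i1 := integrableZl mRpos (L * 2 `^ (- 2^-1) / Gamma (1 + a)) (integrable_gamma _ ia).
apply: le_integrable i1 => //.
  apply/measurable_EFinP; apply: measurable_funTS.
  exact: (measurableT_comp mf0 (pair1_measurable r)).
move=> s /Rpos_gt0 s0; rewrite /= lee_fin (ger0_norm (f0_ge0 _)).
apply: (le_trans _ (ler_norm _)).
have -> : L * 2 `^ (- 2^-1) / Gamma (1 + a) * (s `^ (a - 2^-1) * expR (- s)) =
    w s * ((tau s)^-1 * L).
  rewrite /w powRD; last by apply/implyP => _; rewrite gt_eqF.
  rewrite /tau -powRN powRM ?(ltW s0)//; ring.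
rewrite /f0/= (ler_wpM2l (w0 s))//.
by rewrite ler_wpM2l ?invr_ge0 ?powR_ge0.
Qed.

(** The density of [tau S * X]. *)
Let Phi (r : R) : R := \int[mu]_(s in Rpos) f0 (r, s).

Let EFin_Phi r : (\int[mu]_(s in Rpos) (f0 (r, s))%:E = (Phi r)%:E)%E.
Proof. by rewrite /Phi /Rintegral fineK//; exact: integrable_fin_num (integrable_f0 r). Qed.

Let Phi_ge0 r : 0 <= Phi r.
Proof. by rewrite -lee_fin -EFin_Phi; apply: integral_ge0 => s _; rewrite lee_fin f0_ge0. Qed.

Let mPhi : measurable_fun [set: TR] Phi.
Proof.
apply/measurable_EFinP.
have mf0' : measurable_fun setT (EFin \o f0) by exact/measurable_EFinP.
have f0' z : (0 <= (EFin \o f0) z)%E by rewrite lee_fin f0_ge0.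
have := @measurable_fubini_tonelli_in1 R _ _ TR TR mu setT Rpos measurableT mRpos _ mf0' f0'.
by apply: eq_measurable_fun => r _ /=; rewrite EFin_Phi.
Qed.

Let inner_scale (g : TR -> \bar R) s : 0 < s -> mu.-integrable Rpos g ->
  (\int[mu]_(r in Rpos) ((tau s)^-1%:E * g (r / tau s)%R) = \int[mu]_(u in Rpos) g u)%E.
Proof.
move=> s0 ig; have ti0 : 0 < (tau s)^-1 by rewrite invr_gt0 tau_gt0.
have E : (\int[mu]_(x in Rpos) ((tau s)^-1%:E * g x) =
  (tau s)^-1%:E * \int[mu]_(x in Rpos) g x)%E by rewrite integralZl.
have := integral_scale _ _ ti0 (integrableZl mRpos (tau s)^-1 ig).
rewrite E muleA invrK -EFinM mulfV ?gt_eqF ?tau_gt0// mul1e => <-.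
by apply: eq_integral => r _; rewrite mulrC.
Qed.

Let tail_h s r : 0 < s -> 0 <= r ->
  (\int[mu]_(u in Rpos) ((tau s)^-1 * phi (u / tau s) * (r < u)%R%:R)%:E =
   (h (r / tau s))%:E)%E.
Proof.
move=> s0 r0; have t0 := tau_gt0 s s0.
have rt0 : 0 <= r / tau s by rewrite divr_ge0// ltW.
pose g (u : TR) : \bar R := ((EFin \o phi) \_ `](r / tau s)%R, +oo[) u.
have ig : mu.-integrable Rpos g.
  apply: le_integrable integrable_phi => //.
    apply: measurable_funTS; apply/(measurable_restrictT _ _).1 => //.
    by apply/measurable_EFinP; exact: measurable_funTS.
  move=> u _; rewrite /g patchE; case: ifPn => //= _.
  by rewrite normr0 lee_fin.
rewrite -tail//.
have -> : (\int[mu]_(u in `](r / tau s)%R, +oo[) (phi u)%:E = \int[mu]_(u in Rpos) g u)%E.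
  rewrite /g -integral_mkcondr; congr (integral _ _ _).
  apply/seteqP; split=> u /=; rewrite !in_itv/= !andbT; last by case.
  by move=> ru; split=> //; exact: le_lt_trans ru.
rewrite -(inner_scale g s s0 ig); apply: eq_integral => u _.
rewrite /g patchE mem_setE in_itv/= andbT ltr_pM2r ?invr_gt0//.
by case: ifPn => _; rewrite ?mulr1 ?mulr0 ?mule0//= EFinM.
Qed.

Let tail_Phi r : 0 <= r -> (\int[mu]_(s in `]r, +oo[) (Phi s)%:E = (H r)%:E)%E.
Proof.
move=> r0; rewrite -HE//.
pose f1 (z : TR * TR) : \bar R := (f0 z * \1_(`]r, +oo[%classic : set TR) z.1)%:E.
have mf1 : measurable_fun setT f1.
  apply/measurable_EFinP; apply: measurable_funM => //.
  by apply: (measurableT_comp _ measurable_fst); exact: measurable_indic.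
have f1_ge0 z : (0 <= f1 z)%E by rewrite lee_fin mulr_ge0// f0_ge0.
transitivity (\int[mu]_(s in Rpos) \int[mu]_(u in Rpos) f1 (u, s))%E; last first.
  apply: eq_integral => s; rewrite inE => /Rpos_gt0 s0.
  rewrite EFinM -(tail_h s r s0 r0) -ge0_integralZl_EFin//; last 2 first.
  - by move=> u _; rewrite lee_fin !mulr_ge0 ?phi_ge0// invr_ge0 powR_ge0.
  - apply/measurable_EFinP; apply: measurable_funTS; apply: measurable_funM.
      apply: measurable_funM => //; apply: (measurableT_comp mphi).
      exact: measurable_funM.
    have -> : (fun u : TR => (r < u)%R%:R : R) = \1_(`]r, +oo[%classic : set TR).
      by apply/funext => u; rewrite indicE mem_setE in_itv/= andbT.
    exact: measurable_indic.
  apply: eq_integral => u _; rewrite /f1 /f0/= indicE mem_setE in_itv/= andbT.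
  by rewrite -EFinM; congr EFin; ring.
rewrite -(@fubini_tonelli_in R _ _ TR TR mu mu Rpos Rpos mRpos mRpos f1 mf1 f1_ge0).
transitivity (\int[mu]_(u in Rpos) ((EFin \o Phi) \_ `]r, +oo[) u)%E.
  rewrite -integral_mkcondr; congr (integral _ _ _).
  apply/seteqP; split=> u /=; rewrite !in_itv/= !andbT; last by case.
  by move=> ru; split=> //; exact: le_lt_trans ru.
apply: eq_integral => u _; rewrite patchE /f1 /= indicE; case: ifPn => _.
  by rewrite -EFin_Phi; apply: eq_integral => s _; rewrite mulr1.
by apply: esym; apply: integral0_eq => s _; rewrite mulr0.
Qed.

Let Phi_np r : r <= 0 -> Phi r = 0.
Proof.
move=> r0; rewrite /Phi /Rintegral integral0_eq// => s /Rpos_gt0 s0.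
rewrite /f0/= phi_np ?mulr0//.
by rewrite pmulr_lle0 ?invr_gt0 ?tau_gt0.
Qed.

Let integrable_Phi : mu.-integrable setT (EFin \o Phi).
Proof.
apply/integrableP; split; first exact/measurable_EFinP.
have -> : (\int[mu]_x `|(EFin \o Phi) x| = \int[mu]_(x in Rpos) (Phi x)%:E)%E.
  rewrite [RHS]integral_mkcond; apply: eq_integral => x _; rewrite patchE.
  rewrite mem_setE in_itv/= andbT ger0_norm//.
  by case: ltP => // x0; rewrite Phi_np.
by rewrite tail_Phi// ltry.
Qed.

Let lnphi := integrable_density_ln phi L D mphi phi_bnd phiD integrable_phi.

Let A1 : R := \int[mu]_(u in Rpos) `|phi u * ln u|.

Let EFin_A1 : (\int[mu]_(u in Rpos) (`|phi u * ln u|)%:E = A1%:E)%E.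
Proof.
rewrite /A1 /Rintegral fineK//.
exact: integrable_fin_num (integrable_abse lnphi).
Qed.

Let gl (s u : R) : R := phi u * ln u + ln (tau s) * phi u.

Let integrable_gl s : mu.-integrable Rpos (EFin \o gl s).
Proof.
have -> : EFin \o gl s = (EFin \o (fun u => phi u * ln u)) \+
    (fun u => (ln (tau s))%:E * (EFin \o phi) u)%E by [].
by apply: integrableD => //; exact: integrableZl.
Qed.

Let f0_ln s r : 0 < s -> 0 < r ->
  f0 (r, s) * ln r = w s * ((tau s)^-1 * gl s (r / tau s)).
Proof.
move=> s0 r0; have t0 := tau_gt0 s s0.
have -> : ln r = ln (r / tau s) + ln (tau s).
  by rewrite -lnM ?posrE ?divr_gt0// divfK// gt_eqF.
by rewrite /f0 /gl/=; ring.
Qed.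

Let mgl s : measurable_fun [set: TR] (gl s).
Proof. by apply: measurable_funD; apply: measurable_funM. Qed.

Let measurable_gl_scale s :
  measurable_fun Rpos (fun r : TR => (tau s)^-1 * gl s (r / tau s) : R).
Proof.
apply: measurable_funTS; apply: measurable_funM => //.
apply: (measurableT_comp (mgl s)); exact: measurable_funM.
Qed.

(** The bound that makes Fubini's theorem applicable to the logarithm against
    the joint density. *)
Let norm_moment_le s : 0 < s ->
  (\int[mu]_(r in Rpos) (`|f0 (r, s) * ln r|)%:E <= (w s * (A1 + `|ln (tau s)|))%:E)%E.
Proof.
move=> s0; have t0 := tau_gt0 s s0.
pose g (u : TR) : \bar R := (`|gl s u|)%:E.
have ig : mu.-integrable Rpos g by exact: integrable_abse (integrable_gl s).
have -> : (\int[mu]_(r in Rpos) (`|f0 (r, s) * ln r|)%:E =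
   \int[mu]_(r in Rpos) ((w s)%:E * ((tau s)^-1%:E * g (r / tau s)%R)))%E.
  apply: eq_integral => r; rewrite inE => /Rpos_gt0 r0.
  rewrite /g -!EFinM f0_ln// normrM (ger0_norm (w0 s)) normrM.
  by rewrite (@ger0_norm _ (tau s)^-1)// invr_ge0 powR_ge0.
rewrite ge0_integralZl_EFin//; last 2 first.
- by move=> r _; rewrite -EFinM lee_fin mulr_ge0// invr_ge0 powR_ge0.
- apply/measurable_EFinP; apply: measurable_funTS; apply: measurable_funM => //.
  apply: measurableT_comp => //; apply: (measurableT_comp (mgl s)).
  exact: measurable_funM.
rewrite (inner_scale g s s0 ig) (EFinM (w s)).
apply: lee_wpmul2l; first by rewrite lee_fin w0.
rewrite EFinD -EFin_A1 -[X in (_ <= _ + X)%E]mule1 -integral_phi.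
rewrite -ge0_integralZl_EFin//; last 2 first.
- by move=> u _; rewrite lee_fin phi_ge0.
- by apply/measurable_EFinP; exact: measurable_funTS.
rewrite -ge0_integralD//; last 3 first.
- apply/measurable_EFinP; apply: measurable_funTS; apply: measurableT_comp => //.
  exact: measurable_funM.
- by move=> u _; rewrite -EFinM lee_fin mulr_ge0// phi_ge0.
- apply/measurable_EFinP; apply: measurable_funTS; exact: measurable_funM.
apply: ge0_le_integral => //.
- by move=> u _; rewrite lee_fin.
- apply/measurable_EFinP; apply: measurable_funTS; exact: measurableT_comp.
- apply/measurable_EFinP; apply: measurable_funTS; apply: measurable_funD.
    by apply: measurableT_comp => //; exact: measurable_funM.
  exact: measurable_funM.
- move=> u _; rewrite /g -EFinM -EFinD lee_fin /gl (le_trans (ler_normD _ _))//.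
  by rewrite lerD2l normrM (ger0_norm (phi_ge0 u)).
Qed.

Let moment s : 0 < s -> (\int[mu]_(r in Rpos) (f0 (r, s) * ln r)%:E =
  (w s * (\int[mu]_(u in Rpos) (phi u * ln u) + ln (tau s)))%:E)%E.
Proof.
move=> s0; have t0 := tau_gt0 s s0.
have ig := integrable_gl s.
have -> : (\int[mu]_(r in Rpos) (f0 (r, s) * ln r)%:E =
   \int[mu]_(r in Rpos) ((w s)%:E * ((tau s)^-1%:E * (EFin \o gl s) (r / tau s)%R)))%E.
  apply: eq_integral => r; rewrite inE => /Rpos_gt0 r0.
  by rewrite /= -!EFinM f0_ln.
have ig' : mu.-integrable Rpos (fun r => (tau s)^-1%:E * (EFin \o gl s) (r / tau s)%R)%E.
  apply/integrableP; split; first exact/measurable_EFinP.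
  have ia : mu.-integrable Rpos (abse \o (EFin \o gl s)) by exact: integrable_abse.
  have -> : (\int[mu]_(r in Rpos) `|(tau s)^-1%:E * (EFin \o gl s) (r / tau s)%R| =
      \int[mu]_(r in Rpos) ((tau s)^-1%:E * (abse \o (EFin \o gl s)) (r / tau s)%R))%E.
    apply: eq_integral => r _; rewrite /= -EFinM normrM.
    by rewrite (@ger0_norm _ (tau s)^-1)// invr_ge0 powR_ge0.
  rewrite (inner_scale _ s s0 ia).
  by have /integrableP[] := ig.
rewrite integralZl// (inner_scale _ s s0 ig) (EFinM (w s)); congr (_ * _)%E.
pose pl (u : R) : R := phi u * ln u.
have -> : (\int[mu]_(u in Rpos) (EFin \o gl s) u =
   \int[mu]_(u in Rpos) ((EFin \o pl) u + (ln (tau s))%:E * (EFin \o phi) u))%E by [].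
rewrite integralD//; last exact: integrableZl.
rewrite integralZl// [X in (_ + _ * X)%E]integral_phi mule1 EFinD; congr (_ + _)%E.
by rewrite /Rintegral fineK//; exact: integrable_fin_num lnphi.
Qed.

Lemma log_moment_mixture_density :
  \int[mu]_(r in Rpos) (- derive1 H r * ln r) =
  \int[mu]_(r in Rpos) (- derive1 h r * ln r) + 2^-1 * (ln 2 + digamma (1 + a)).
Proof.
rewrite (@log_moment_derive1 h phi); last 2 first.
- have := (@integrable_mkcond _ TR R mu Rpos (fun x : TR => (phi x)%:E) mRpos).1 integrable_phi.
  apply: eq_integrable => // x _; rewrite patchE mem_setE in_itv/= andbT.
  by case: ltP => // x0; rewrite phi_np.
- by move=> r r0; rewrite tail// ltW.
rewrite (@log_moment_derive1 H Phi integrable_Phi); last first.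
  by move=> r r0; rewrite tail_Phi// ltW.
set A := \int[mu]_(r in Rpos) (phi r * ln r).
have mln : measurable_fun [set: TR] (@ln R : TR -> R) by exact: measurable_ln.
have mRlnf : measurable_fun setT (fun z : TR * TR => (f0 z * ln z.1)%:E).
  apply/measurable_EFinP; apply: measurable_funM => //.
  exact: (measurableT_comp mln measurable_fst).
transitivity (fine (\int[mu]_(r in Rpos) \int[mu]_(s in Rpos) (f0 (r, s) * ln r)%:E)%E).
  rewrite /Rintegral; congr fine; apply: eq_integral => r _.
  rewrite mulrC EFinM -EFin_Phi -integralZl//.
  by apply: eq_integral => s _; rewrite -EFinM mulrC.
have fin_dom : (\int[mu]_(s in Rpos) \int[mu]_(r in Rpos) `|(f0 (r, s) * ln r)%:E| < +oo)%E.
  have iB : mu.-integrable Rpos (EFin \o (fun s : R => w s * (A1 + `|ln (tau s)|))).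
    have i1 := integrableD mRpos (integrableZl mRpos A1 integrable_w) (integrable_abse integrable_w_ln).
    apply: eq_integrable i1 => // s _ /=.
    by rewrite -EFinM -EFinD normrM (ger0_norm (w0 s)) mulrDr [A1 * _]mulrC.
  pose F (z : TR * TR) : \bar R := (`|f0 (z.2, z.1) * ln z.2|)%:E.
  have mF : measurable_fun setT F.
    have mG : measurable_fun setT (fun z : TR * TR => f0 (z.2, z.1) * ln z.2 : R).
      apply: measurable_funM; last exact: (measurableT_comp mln measurable_snd).
      exact: (measurableT_comp mf0 (@measurable_swap _ _ TR TR)).
    by apply/measurable_EFinP; apply: measurableT_comp.
  have F0 z : (0 <= F z)%E by rewrite lee_fin.
  have mI := @measurable_fubini_tonelli_in1 R _ _ TR TR mu Rpos Rpos mRpos mRpos _ mF F0.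
  apply: le_lt_trans (_ : (\int[mu]_(s in Rpos) (w s * (A1 + `|ln (tau s)|))%:E < +oo)%E).
    apply: ge0_le_integral => //.
    - by move=> s _; apply: integral_ge0.
    - exact: measurable_int iB.
    - by move=> s /Rpos_gt0 s0; exact: norm_moment_le.
  move/integrableP : iB => [_]; apply: le_lt_trans.
  rewrite le_eqVlt; apply/orP; left; apply/eqP; apply: eq_integral => s _.
  have A10 : 0 <= A1 by apply: Rintegral_ge0.
  have b0 : 0 <= w s * (A1 + `|ln (tau s)|).
    by apply: mulr_ge0; [exact: w0|exact: addr_ge0].
  by rewrite /= (ger0_norm b0).
rewrite (@Fubini_in R _ _ TR TR mu mu Rpos Rpos mRpos mRpos _ mRlnf fin_dom).
transitivity (\int[mu]_(s in Rpos) (A * w s + w s * ln (tau s))).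
  rewrite /Rintegral; congr fine; apply: eq_integral => s; rewrite inE => /Rpos_gt0 s0.
  by rewrite moment// -/A mulrDr mulrC.
have iA : mu.-integrable Rpos (EFin \o (fun s => A * w s)).
  by have := integrableZl mRpos A integrable_w.
rewrite RintegralD//.
rewrite RintegralZl// {1}/Rintegral integral_w mulr1.
by rewrite integral_w_ln.
Qed.

End log_mixture.

End gamma_mixture.

(** * Volume and gauge *)

Section lebesgue_Rn.
Context {R : realType}.
Local Notation TR := (measurableTypeR R).
Local Notation mu := (@lebesgue_measure R).

Definition affine_tuple n (c : R) (b t : n.-tuple TR) : n.-tuple TR :=
  [tuple (c * tnth t i + tnth b i)%R : TR | i < n].

Lemma measurable_affine_tuple n (c : R) (b : n.-tuple TR) :
  measurable_fun setT (affine_tuple n c b).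
Proof.
apply/measurable_fun_tnthP => i.
have -> : @tnth n TR ^~ i \o affine_tuple n c b =
    (fun x : TR => (c * x + tnth b i)%R : TR) \o (@tnth n TR ^~ i).
  by apply/funext => t /=; rewrite tnth_mktuple.
by apply: measurableT_comp; [exact: measurable_affine|exact: measurable_tnth].
Qed.

Lemma affine_tuple_cons n (c a : R) (b : n.+1.-tuple TR) (t : n.-tuple TR) :
  affine_tuple n.+1 c b (cons_pair (a, t)) =
  cons_pair ((c * a + thead b)%R : TR, affine_tuple n c [tuple of behead b] t).
Proof.
apply: eq_from_tnth => i; rewrite tnth_mktuple.
case: (unliftP ord0 i) => [j ->|->].
  rewrite /cons_pair !tnthS tnth_mktuple tnth_behead; congr (_ + tnth _ _).
  by apply/ord_inj; rewrite lift0 inordK// ltnS.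
by rewrite /cons_pair !tnth0.
Qed.

(** Induction on the dimension: a section of the preimage is the preimage of a
    section, and the remaining coordinate contributes one more factor. *)
Lemma lebesgue_tuple_affine n (c : R) (b : n.-tuple TR) (A : set (n.-tuple TR)) :
  0 < c -> measurable A ->
  lebesgue_tuple n (affine_tuple n c b @^-1` A) =
  ((c^-1 ^+ n)%:E * lebesgue_tuple n A)%E.
Proof.
move=> c0; elim: n b A => [|n IH] b A mA.
  rewrite expr0 mul1e; congr (lebesgue_tuple 0 _).
  by apply/seteqP; split=> t; rewrite /= (tuple0 t) (tuple0 (affine_tuple _ _ _ _)).
pose B := @cons_pair _ TR n @^-1` A.
have mB : measurable B.
  by rewrite -[B]setTI; exact: measurable_cons_pair.
have sect a : xsection (@cons_pair _ TR n @^-1` (affine_tuple n.+1 c b @^-1` A)) a =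
    affine_tuple n c [tuple of behead b] @^-1` xsection B (c * a + thead b)%R.
  by apply/seteqP; split=> t; rewrite /xsection/= !inE/= affine_tuple_cons.
transitivity (\int[mu]_a lebesgue_tuple n
   (xsection (@cons_pair _ TR n @^-1` (affine_tuple n.+1 c b @^-1` A)) a))%E; first by [].
transitivity (\int[mu]_a ((c^-1 ^+ n)%:E * lebesgue_tuple n (xsection B (c * a + thead b)%R)))%E.
  apply: eq_integral => a _; rewrite sect IH//; exact: measurable_xsection.
pose F := (lebesgue_tuple n \o xsection B).
have mF : measurable_fun setT F by exact: measurable_fun_xsection.
have F0 x : (0 <= F x)%E by exact: measure_ge0.
have := @ge0_integral_affine R c (thead b) setT (fun x => (c^-1 ^+ n)%:E * F x)%E c0 measurableT.
rewrite preimage_setT => ->; last 2 first.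
- by apply: measurable_funeM.
- by move=> x _; rewrite mule_ge0// lee_fin exprn_ge0// invr_ge0 ltW.
rewrite ge0_integralZl_EFin//; last by rewrite exprn_ge0// invr_ge0 ltW.
by rewrite muleA -EFinM -exprS.
Qed.

(** Measurability is that of tuples, on which the volume is defined. *)
Definition Rn_measurable n (A : set 'rV[R]_n) : Prop :=
  measurable (@row_of_tuple R n @^-1` A : set (n.-tuple TR)).

(** An open set is the countable union of the rational cubes that it contains. *)
Lemma open_Rn_measurable n (U : set 'rV[R]_n) : open U -> Rn_measurable n U.
Proof.
move=> oU; rewrite /Rn_measurable.
pose box (i : {ffun 'I_n -> rat} * nat) : set (n.-tuple TR) :=
  [set t | forall j, `|tnth t j - ratr (i.1 j)| < i.2.+1%:R^-1 :> R].
pose I := [set i | box i `<=` @row_of_tuple R n @^-1` U].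
have -> : @row_of_tuple R n @^-1` U = \bigcup_(i in I) box i.
  apply/seteqP; split=> [t Ut|t [i Ii it]]; last exact: Ii.
  have [e /= e0 eU] : exists2 e : R, 0 < e & ball (row_of_tuple t) e `<=` U.
    by apply/nbhs_ballP; exact: open_nbhs_nbhs.
  have [k ke] : exists k : nat, k.+1%:R^-1 < e / 2.
    have e20 : 0 < (e / 2)^-1 by rewrite invr_gt0 divr_gt0.
    exists (Num.truncn (e / 2)^-1); rewrite -[ltRHS]invrK ltf_pV2 ?posrE//.
    exact: truncnS_gt.
  have rk j : exists q : rat, `|tnth t j - ratr q| < k.+1%:R^-1.
    have := @rat_in_itvoo R (tnth t j - k.+1%:R^-1) (tnth t j + k.+1%:R^-1).
    case; first by rewrite ltrD2l -subr_gt0 opprK addr_gt0 ?invr_gt0.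
    by move=> q; rewrite in_itv/= => /andP[q1 q2]; exists q; rewrite distrC ltr_distl q1 q2.
  have /choice[q qP] := rk.
  exists ([ffun j => q j], k); last by move=> j /=; rewrite ffunE.
  move=> u uq /=; apply: eU; split => // i j; rewrite !mxE.
  rewrite /ball/= (le_lt_trans (ler_distD (ratr (q j)) _ _))//.
  rewrite (splitr e) ltrD//; apply: (lt_trans _ ke); first exact: qP.
  by rewrite distrC; have := uq j; rewrite /= ffunE.
rewrite bigcup_mkcond; apply: countable_bigcupT_measurable => [|i].
  exact: countableP.
case: ifPn => // _.
have -> : box i = \bigcap_(j in [set: 'I_n])
    ((@tnth n TR ^~ j) @^-1` (ball (ratr (i.1 j) : R) i.2.+1%:R^-1)).
  apply/seteqP; split=> t /=.
    by move=> it j _ /=; rewrite /ball/= distrC; exact: it.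
  by move=> it j; have := it j Logic.I; rewrite /ball/= distrC.
apply: fin_bigcap_measurable => [|j _]; first exact: finite_finset.
rewrite -[X in measurable X]setTI; apply: measurable_tnth => //.
exact: measurable_ball.
Qed.

Lemma closed_Rn_measurable n (A : set 'rV[R]_n) : closed A -> Rn_measurable n A.
Proof.
move=> cA; rewrite /Rn_measurable -[A]setCK preimage_setC; apply: measurableC.
by have := open_Rn_measurable n _ (closed_openC cA).
Qed.

Lemma vol_affine n (c : R) (b : 'rV[R]_n) (A : set 'rV[R]_n) :
  0 < c -> Rn_measurable n A ->
  vol ((fun x => c *: x + b) @^-1` A) = ((c^-1 ^+ n)%:E * vol A)%E.
Proof.
move=> c0 mA; rewrite /vol.
rewrite -(@lebesgue_tuple_affine n c [tuple b ord0 i | i < n])//.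
congr (lebesgue_tuple n _); apply/seteqP; split=> t /=; rewrite /preimage/=.
  by congr A; apply/rowP => i; rewrite !mxE !tnth_mktuple.
by congr A; apply/rowP => i; rewrite !mxE !tnth_mktuple.
Qed.

Lemma vol_ge0 n (A : set 'rV[R]_n) : (0 <= vol A)%E.
Proof. exact: measure_ge0. Qed.

Lemma le_vol n (A B : set 'rV[R]_n) : Rn_measurable n A -> Rn_measurable n B ->
  A `<=` B -> (vol A <= vol B)%E.
Proof.
by move=> mA mB AB; apply: le_measure; rewrite ?inE// => t /=; exact: AB.
Qed.

(** The norm of row vectors is the maximum norm: its balls are open cubes. *)
Lemma vol_ball n (c : 'rV[R]_n) (r : R) : 0 < r ->
  vol (ball c r) = ((2 * r) ^+ n)%:E.
Proof.
move=> r0; rewrite /vol.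
transitivity (lebesgue_tuple n
    [set t : n.-tuple TR | forall i, (ball (c ord0 i) r : set TR) (tnth t i)]).
  congr (lebesgue_tuple n _); apply/seteqP; split=> t /=.
    by move=> [_ tr] i; have := tr ord0 i; rewrite mxE.
  by move=> tr; split=> // i j; rewrite mxE (ord1 i); exact: tr.
transitivity (\prod_(i < n) mu (ball (c ord0 i) r))%E.
  by apply: lebesgue_tuple_box => i; exact: measurable_ball.
under eq_bigr do rewrite lebesgue_measure_ball ?ltW//.
rewrite -(big_morph EFin EFinM erefl) prodr_const card_ord.
by rewrite mulr2n mulrDl mul1r.
Qed.

Lemma bounded_sub_ball n (A : set 'rV[R]_n) : bounded_set A ->
  exists2 M : R, 0 < M & A `<=` ball 0 M.
Proof.
move=> bA; have [N [_ AN]] := bA; exists (`|N| + 2); first by rewrite ltr_wpDl.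
move=> x Ax; rewrite -ball_normE /= sub0r normrN.
have /AN/(_ x Ax)/le_lt_trans : N < `|N| + 1 by rewrite (le_lt_trans (ler_norm _))// ltrDl.
by apply; rewrite ltrD2l ltr1n.
Qed.

Lemma vol_lty n (A : set 'rV[R]_n) : Rn_measurable n A -> bounded_set A ->
  (vol A < +oo)%E.
Proof.
move=> mA bA; have [M M0 AM] := bounded_sub_ball n A bA.
apply: (@le_lt_trans _ _ (vol (ball (0 : 'rV[R]_n) M))).
  apply: le_vol => //; apply: open_Rn_measurable; exact: ball_open.
by rewrite vol_ball// ltry.
Qed.

Section convex.
Variables (n : nat) (K : set 'rV[R]_n).
Hypotheses (cvxK : convex_set K) (K0 : K 0) (cK : compact K).

Lemma convex_setP x y (l : R) : K x -> K y -> 0 <= l <= 1 ->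
  K (l *: x + (1 - l) *: y).
Proof.
move=> Kx Ky /andP[l0 l1].
have l01 : Itv.spec (@Itv.num_sem R) (Itv.Real `[0%Z, 1%Z]) l.
  by rewrite /Itv.spec/Itv.num_sem/= in_itv/= l0 l1 ger0_real.
have := cvxK x y (Itv.mk l01); rewrite !inE.
by move=> /(_ Kx Ky).
Qed.

Lemma convex_scale x (l : R) : K x -> 0 <= l <= 1 -> K (l *: x).
Proof. by move=> Kx l01; have := convex_setP x 0 l Kx K0 l01; rewrite scaler0 addr0. Qed.

Lemma compact_rV_closed : closed K.
Proof. by apply: compact_closed cK; exact: norm_hausdorff. Qed.

Lemma compact_Rn_measurable : Rn_measurable n K.
Proof. by apply: closed_Rn_measurable; exact: compact_rV_closed. Qed.

(** The infimum defining the gauge is attained: for [s > t] the point [x / s] is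
    in [K], and [K] is closed. *)
Lemma gauge_le (x : 'rV[R]_n) (t : R) : 0 < t ->
  (gauge K x <= t%:E)%E <-> K (t^-1 *: x).
Proof.
move=> t0; split; last first.
  move=> Ktx; apply: ereal_inf_lbound => /=; exists t => //; split=> //.
  by exists (t^-1 *: x) => //; rewrite scalerA mulfV ?scale1r// gt_eqF.
move=> gt.
have Ks s : t < s -> K (s^-1 *: x).
  move=> ts; have : (gauge K x < s%:E)%E by rewrite (le_lt_trans gt)// lte_fin.
  move=> /ereal_inf_lt[_ [u /= [u0 [y Ky <-]] <-]]; rewrite lte_fin => us.
  rewrite scalerA; apply: convex_scale => //.
  have s0 : 0 < s by exact: lt_trans us.
  rewrite mulrC ler_pdivrMr// mul1r (ltW us) andbT.
  by rewrite divr_ge0// ltW.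
have cvgx : (s^-1 *: x) @[s --> t^'+] --> t^-1 *: x.
  apply: cvg_at_right_filter; apply: cvgZr_tmp.
  by apply: cvgV; [rewrite gt_eqF|exact: cvg_id].
apply: (@closed_cvg _ _ _ _ _ K compact_rV_closed _ _ cvgx).
by near=> s; apply: Ks; near: s; exact: nbhs_right_gt.
Unshelve. all: by end_near. Qed.

Lemma gauge_ge0 (x : 'rV[R]_n) : (0 <= gauge K x)%E.
Proof. by apply: le_ereal_inf_tmp => _ [t [t0 _] <-]; rewrite lee_fin ltW. Qed.

Lemma gaussian_bounds (x : 'rV[R]_n) : 0 <= gaussian K x <= 1.
Proof.
rewrite /gaussian; have := gauge_ge0 x; case: (gauge K x) => [r| |]//= r0.
  rewrite expR_ge0/= -expR0 ler_expR oppr_le0 mulr_ge0//.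
  by rewrite -expr2 sqr_ge0.
by rewrite gt0_mulye ?lte_fin//= lexx ler01.
Qed.

(** Both sides say that the gauge is at most [tau s]; so the superlevel sets of the
    Gaussian are the dilates of [K]. *)
Lemma expRN_le_gaussian (x : 'rV[R]_n) (s : R) : 0 < s ->
  (expR (- s) <= gaussian K x) = `[< K ((tau s)^-1 *: x) >].
Proof.
move=> s0; have t0 := tau_gt0 s s0.
have tau2 : tau s ^+ 2 = 2 * s.
  rewrite /tau -powR_mulrn ?powR_ge0// -powRrM mulVf ?pnatr_eq0// powRr1//.
  by rewrite mulr_ge0// ltW.
have -> : `[< K ((tau s)^-1 *: x) >] = (gauge K x <= (tau s)%:E)%E.
  by apply/asboolP/idP => /(gauge_le x _ t0).
rewrite /gaussian; have := gauge_ge0 x; case: (gauge K x) => [r| |]//= r0.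
  rewrite ler_expR lee_fin lerN2.
  rewrite -[RHS](@ler_pXn2r _ 2)// ?nnegrE ?(ltW t0)// tau2.
  by rewrite -expr2 ler_pdivrMr// [s * _]mulrC.
by rewrite gt0_mulye ?lte_fin//= leNgt expR_gt0.
Qed.

End convex.

End lebesgue_Rn.

(** * The covariograms of a body and of its Gaussian *)

Section covariogram.
Context {R : realType}.
Local Notation TR := (measurableTypeR R).
Local Notation mu := (@lebesgue_measure R).
Local Notation Rpos := (`]0%R, +oo[%classic : set TR).
Variables (m n : nat) (K : set 'rV[R]_n).
Hypothesis (hK : convex_body K) (K0 : K 0).

Let cvxK : convex_set K. Proof. by case: hK. Qed.
Let cK : compact K. Proof. by case: hK. Qed.
Let mK : Rn_measurable n K. Proof. exact: compact_Rn_measurable. Qed.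

Definition overlap (x : 'M[R]_(m, n)) : set 'rV[R]_n :=
  [set y | K y /\ forall i, K (y - row i x)].

Lemma translateE (v y : 'rV[R]_n) : translate v K y <-> K (y - v).
Proof.
split=> [[z Kz <-]|Kyv]; first by rewrite addrC addKr.
by exists (y - v) => //; rewrite addrC subrK.
Qed.

Lemma overlapE (x : 'M[R]_(m, n)) :
  K `&` \bigcap_(i in [set: 'I_m]) translate (row i x) K = overlap x.
Proof.
apply/seteqP; split=> y /= [Ky yx]; split=> //.
  by move=> i; apply/translateE; exact: yx.
by move=> i _; apply/translateE; exact: yx.
Qed.

Lemma vol_translate (v : 'rV[R]_n) (A : set 'rV[R]_n) : Rn_measurable n A ->
  vol [set y | A (y - v)] = vol A.
Proof.
move=> mA; have := vol_affine n 1 (- v) A ltr01 mA.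
rewrite invr1 expr1n mul1e => <-; congr vol.
by apply/seteqP; split=> y /=; rewrite scale1r.
Qed.

Lemma Rn_measurable_translate (v : 'rV[R]_n) (A : set 'rV[R]_n) :
  Rn_measurable n A -> Rn_measurable n [set y | A (y - v)].
Proof.
move=> mA; rewrite /Rn_measurable.
have := measurable_affine_tuple n 1 [tuple (- v) ord0 i | i < n] measurableT _ mA.
rewrite setTI; congr measurable; apply/seteqP; split=> t /=;
  by congr A; apply/rowP => i; rewrite !mxE !tnth_mktuple mul1r mxE.
Qed.

Lemma Rn_measurable_bigcap I (D : set I) (F : I -> set 'rV[R]_n) :
  finite_set D -> (forall i, Rn_measurable n (F i)) ->
  Rn_measurable n (\bigcap_(i in D) F i).
Proof.
move=> finD mF; rewrite /Rn_measurable preimage_bigcap.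
by apply: fin_bigcap_measurable => // i _; exact: mF.
Qed.

Lemma Rn_measurableD (A B : set 'rV[R]_n) :
  Rn_measurable n A -> Rn_measurable n B -> Rn_measurable n (A `\` B).
Proof. by move=> mA mB; exact: (measurableD mA mB). Qed.

Lemma measurable_overlap (x : 'M[R]_(m, n)) : Rn_measurable n (overlap x).
Proof.
have -> : overlap x = K `&` \bigcap_(i in [set: 'I_m]) [set y | K (y - row i x)].
  by apply/seteqP; split=> y /= [Ky yx]; split=> // i; [move=> _|]; exact: yx.
rewrite /Rn_measurable preimage_setI; apply: measurableI; first exact: mK.
apply: Rn_measurable_bigcap => [|i]; first exact: finite_finset.
exact: Rn_measurable_translate.
Qed.

Lemma vol_K_lty : (vol K < +oo)%E.
Proof. by apply: vol_lty; [exact: mK|exact: compact_bounded]. Qed.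

Lemma vol_overlap_le (x : 'M[R]_(m, n)) : (vol (overlap x) <= vol K)%E.
Proof. by apply: le_vol; [exact: measurable_overlap|exact: mK|move=> y []]. Qed.

Lemma EFin_covariogram (x : 'M[R]_(m, n)) : (covariogram K x)%:E = vol (overlap x).
Proof.
rewrite /covariogram overlapE fineK// ge0_fin_numE ?vol_ge0//.
exact: le_lt_trans (vol_overlap_le x) vol_K_lty.
Qed.

Lemma covariogram_ge0 (x : 'M[R]_(m, n)) : 0 <= covariogram K x.
Proof. by rewrite -lee_fin EFin_covariogram vol_ge0. Qed.

Lemma overlap0 : overlap 0 = K.
Proof.
apply/seteqP; split=> y /=; first by case.
by move=> Ky; split=> // i; rewrite row0 subr0.
Qed.

Lemma covariogram_le (x : 'M[R]_(m, n)) : covariogram K x <= covariogram K (0 : 'M[R]_(m, n)).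
Proof. by rewrite -lee_fin !EFin_covariogram overlap0 vol_overlap_le. Qed.

Lemma convex_body_ball : exists c r, 0 < r /\ ball c r `<=` K.
Proof.
case: hK => _ _ [c /nbhs_ballP[r /= r0 rK]].
by exists c, r.
Qed.

Lemma covariogram0_gt0 : 0 < covariogram K (0 : 'M[R]_(m, n)).
Proof.
have [c [r [r0 rK]]] := convex_body_ball.
rewrite -lte_fin EFin_covariogram overlap0.
apply: (@lt_le_trans _ _ (vol (ball c r))).
  by rewrite vol_ball// lte_fin exprn_gt0// mulr_gt0.
by apply: le_vol => //; apply: open_Rn_measurable; exact: ball_open.
Qed.

(** [y - u x] is between [y - v x] and [y], so it stays in the convex set. *)
Lemma overlap_scale_sub (x : 'M[R]_(m, n)) (u v : R) : 0 <= u <= v ->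
  overlap (v *: x) `<=` overlap (u *: x).
Proof.
move=> /andP[u0]; rewrite le_eqVlt => /predU1P[->//|uv] y [Ky Kx]; split=> // i.
have v0 : 0 < v by exact: le_lt_trans uv.
have -> : y - row i (u *: x) = (u / v) *: (y - row i (v *: x)) + (1 - u / v) *: y.
  apply/rowP => j; rewrite !mxE; field; exact: lt0r_neq0.
apply: convex_setP => //; rewrite divr_ge0 ?(ltW v0)//=.
by rewrite ler_pdivrMr// mul1r ltW.
Qed.

(** The profile of the covariogram in the direction [x], continued to the left
    of 0 by its value at 0 so as to be a tail function on the whole line. *)
Definition ray (x : 'M[R]_(m, n)) (u : R) : R := covariogram K (Num.max u 0 *: x).

Lemma rayE (x : 'M[R]_(m, n)) (u : R) : 0 <= u -> ray x u = covariogram K (u *: x).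
Proof. by move=> u0; rewrite /ray max_l. Qed.

Lemma ray_np (x : 'M[R]_(m, n)) (u : R) : u <= 0 ->
  ray x u = covariogram K (0 : 'M[R]_(m, n)).
Proof. by move=> u0; rewrite /ray max_r// scale0r. Qed.

Lemma ray_nonincreasing (x : 'M[R]_(m, n)) : {homo ray x : u v /~ u <= v}.
Proof.
move=> u v uv; rewrite -lee_fin !EFin_covariogram.
apply: le_vol; [exact: measurable_overlap..|apply: overlap_scale_sub].
by rewrite le_max lexx orbT/= ge_max !le_max uv lexx orbT.
Qed.

Lemma measurable_ray (x : 'M[R]_(m, n)) : measurable_fun [set: TR] (ray x).
Proof.
apply: nonincreasing_measurable => // u v uv.
exact: (ray_nonincreasing x _ _ uv).
Qed.

Definition uncovered (w : 'rV[R]_n) : set 'rV[R]_n := [set y | K y /\ ~ K (y - w)].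

Lemma measurable_uncovered (w : 'rV[R]_n) : Rn_measurable n (uncovered w).
Proof.
have -> : uncovered w = K `\` [set y | K (y - w)] by [].
by apply: Rn_measurableD => //; exact: Rn_measurable_translate.
Qed.

(** With [e = 2 |w| / r] small, the copy [(1 - e) K + e c] of [K] is contained
    both in [K] and in its translate by [w], because [e^-1 w] is shorter than
    [r].  So what the translate leaves uncovered has volume at most
    [(1 - (1 - e)^n) vol K], which is at most [n e vol K] by Bernoulli's
    inequality. *)
Lemma vol_uncovered_le (c : 'rV[R]_n) (r : R) : (0 < n)%N -> 0 < r -> ball c r `<=` K ->
  forall w : 'rV[R]_n, (vol (uncovered w) <=
    (n%:R * (2 * `|w| / r) * covariogram K (0 : 'M[R]_(m, n)))%:E)%E.
Proof.
move=> n0 r0 cr w; set g0 := covariogram K (0 : 'M[R]_(m, n)).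
have g0E : vol K = g0%:E by rewrite /g0 EFin_covariogram overlap0.
have g00 : 0 <= g0 by exact: covariogram_ge0.
pose Kw := [set y | K (y - w)].
have mKw : Rn_measurable n Kw by exact: Rn_measurable_translate.
have mD := measurable_uncovered w.
have [w0|w0] := eqVneq w 0.
  rewrite (_ : uncovered w = set0) /vol ?preimage_set0 ?measure0 ?lee_fin ?mulr_ge0//.
    by rewrite invr_ge0 ltW.
  by apply/seteqP; split=> y //= []; rewrite w0 subr0.
have wn0 : 0 < `|w| by rewrite normr_gt0.
set e := 2 * `|w| / r.
have e0 : 0 < e by rewrite divr_gt0// mulr_gt0.
have n1 : (1 : R) <= n%:R by rewrite ler1n.
have [e1|e1] := leP 1 e.
  apply: (@le_trans _ _ (vol K)); first by apply: le_vol => // y [].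
  rewrite g0E lee_fin ler_peMl//; have := ler_pM ler01 ler01 n1 e1.
  by rewrite mulr1.
have e10 : 0 < 1 - e by rewrite subr_gt0.
pose S := [set y | K ((1 - e)^-1 *: y + (- ((1 - e)^-1 * e)) *: c)].
have SE y : S y -> exists2 k, K k & y = (1 - e) *: k + e *: c.
  move=> Sy; exists ((1 - e)^-1 *: y + (- ((1 - e)^-1 * e)) *: c) => //.
  rewrite scalerDr !scalerA mulrN mulrA mulfV ?gt_eqF// mul1r scale1r scaleNr.
  by rewrite subrK.
have Kc : K c by apply: cr; exact: ballxx.
have SK : S `<=` K.
  move=> y /SE[k Kk ->].
  have := convex_setP n K cvxK k c (1 - e) Kk Kc.
  have -> : 1 - (1 - e) = e by ring.
  by apply; rewrite ltW//= gerBl ltW.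
have SKw : S `<=` Kw.
  move=> y /SE[k Kk ->]; rewrite /Kw/=.
  have -> : (1 - e) *: k + e *: c - w = (1 - e) *: k + (1 - (1 - e)) *: (c - e^-1 *: w).
    have -> : 1 - (1 - e) = e by ring.
    by rewrite scalerBr scalerA mulfV ?scale1r ?gt_eqF// addrA.
  apply: convex_setP => //; last by rewrite ltW//= gerBl ltW.
  apply: cr; rewrite -ball_normE /= opprB addrC subrK normrZ.
  rewrite ger0_norm ?invr_ge0 ?(ltW e0)// /e.
  have -> : (2 * `|w| / r)^-1 * `|w| = r / 2.
    by field; rewrite !gt_eqF.
  by rewrite ltr_pdivrMr// mulr_natr mulr2n ltrDl.
have mS : Rn_measurable n S.
  rewrite /Rn_measurable /S.
  have := measurable_affine_tuple n (1 - e)^-1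
    [tuple ((- ((1 - e)^-1 * e)) *: c) ord0 i | i < n] measurableT _ mK.
  rewrite setTI; congr measurable; apply/seteqP; split=> t /=;
    by congr K; apply/rowP => i; rewrite !mxE !tnth_mktuple mxE.
have volS : vol S = (((1 - e) ^+ n) * g0)%:E.
  have -> : S = (fun y => (1 - e)^-1 *: y + (- ((1 - e)^-1 * e)) *: c) @^-1` K by [].
  by rewrite vol_affine ?invr_gt0// invrK g0E.
have bern : 1 - n%:R * e <= (1 - e) ^+ n.
  elim: (n) => [|k IH]; first by rewrite expr0 mul0r subr0.
  rewrite exprS; apply: (@le_trans _ _ ((1 - e) * (1 - k%:R * e))).
    rewrite -natr1; have : 0 <= k%:R * e * e.
      by apply: mulr_ge0; [apply: mulr_ge0 => //|]; exact: ltW.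
    lra.
  by rewrite ler_wpM2l// ltW.
have : (vol (uncovered w) + vol S <= vol K)%E.
  rewrite /vol -measureU//.
    apply: le_measure; rewrite ?inE//; first exact: measurableU.
    by move=> t [[]|] //; exact: SK.
  apply/seteqP; split=> t //= [[_ nK] St]; apply: nK; exact: SKw.
rewrite volS g0E; have := vol_ge0 n (uncovered w).
case: (vol (uncovered w)) => [d| |]//; rewrite -?EFinD !lee_fin => d0.
have : (1 - n%:R * e) * g0 <= (1 - e) ^+ n * g0 by rewrite ler_wpM2r.
lra.
Qed.

(** A point of the overlap at [u x] that is not in the overlap at [v x] is left
    uncovered by one of the [m] translates of [K] as that translate moves
    by [v - u] times a row of [x]. *)
Lemma ray_lipschitz (x : 'M[R]_(m, n)) : (0 < n)%N -> exists2 L : R, 0 < L &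
  forall u v, u <= v -> ray x u - ray x v <= L * (v - u).
Proof.
move=> n0; have [c [r [r0 rK]]] := convex_body_ball.
set g0 := covariogram K (0 : 'M[R]_(m, n)).
have g00 : 0 <= g0 by exact: covariogram_ge0.
pose a (i : 'I_m) := n%:R * (2 * `|row i x| / r) * g0.
have a0 i : 0 <= a i by rewrite /a !mulr_ge0// invr_ge0 ltW.
exists (\sum_i a i + 1); first by rewrite ltr_wpDl// sumr_ge0.
move=> u v uv; set u' := Num.max u 0; set v' := Num.max v 0.
have u'0 : 0 <= u' by rewrite le_max lexx orbT.
have uv' : u' <= v' by rewrite ge_max !le_max uv lexx orbT.
have duv : v' - u' <= v - u.
  rewrite /u' /v'; case: (leP v 0) => v0; case: (leP u 0) => u0; lra.
have dd (i : 'I_m) := vol_uncovered_le c r n0 r0 rK ((v' - u') *: row i x).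
pose E i := [set y | K (y - row i (u' *: x)) /\ ~ K (y - row i (v' *: x))].
have mT (i : 'I_m) (z : R) : Rn_measurable n [set y | K (y - row i (z *: x))].
  exact: Rn_measurable_translate.
have mE i : Rn_measurable n (E i).
  have -> : E i = [set y | K (y - row i (u' *: x))] `\` [set y | K (y - row i (v' *: x))] by [].
  by apply: Rn_measurableD; exact: mT.
have volE i : (vol (E i) <= ((v' - u') * a i)%:E)%E.
  have -> : vol (E i) = vol (uncovered ((v' - u') *: row i x)).
    have mD := measurable_uncovered ((v' - u') *: row i x).
    rewrite -(vol_translate (row i (u' *: x)) _ mD); congr vol.
    apply/seteqP; split=> y; rewrite /E /uncovered/=;
      have -> : y - row i (u' *: x) - (v' - u') *: row i x = y - row i (v' *: x);
      by [apply/rowP => j; rewrite !mxE; ring|].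
  apply: (le_trans (dd i)); rewrite lee_fin normrZ ger0_norm ?subr_ge0// /a -/g0.
  by rewrite le_eqVlt; apply/orP; left; apply/eqP; ring.
have sub : overlap (u' *: x) `<=` overlap (v' *: x) `|` \big[setU/set0]_i E i.
  move=> y [Ky yu]; have [yv|] := pselect (forall i, K (y - row i (v' *: x))).
    by left; split.
  move=> /existsNP[i nKi]; right; rewrite (bigD1 i)//=; left.
  by split=> //; exact: yu.
have : (vol (overlap (u' *: x)) <= vol (overlap (v' *: x)) + \sum_i vol (E i))%E.
  have [mU leU] : Rn_measurable n (\big[setU/set0]_i E i) /\
      (vol (\big[setU/set0]_i E i) <= \sum_i vol (E i))%E.
    apply: (big_ind2 (fun A e => Rn_measurable n A /\ (vol A <= e)%E)).
    - by rewrite /Rn_measurable /vol preimage_set0 measure0.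
    - move=> A a1 B b1 [mA Aa] [mB Bb]; split.
        by rewrite /Rn_measurable preimage_setU; exact: measurableU.
      apply: (@le_trans _ _ (vol A + vol B)%E); last exact: leeD.
      by rewrite /vol preimage_setU; exact: measureU2.
    - by move=> i _; split.
  apply: (@le_trans _ _ (vol (overlap (v' *: x) `|` \big[setU/set0]_i E i))).
    apply: le_vol => //; first exact: measurable_overlap.
    by rewrite /Rn_measurable preimage_setU; apply: measurableU => //; exact: measurable_overlap.
  apply: (@le_trans _ _ (vol (overlap (v' *: x)) + vol (\big[setU/set0]_i E i))%E).
    by rewrite /vol preimage_setU; apply: measureU2 => //; exact: measurable_overlap.
  by rewrite leeD2l.
have : (\sum_i vol (E i) <= ((v' - u') * \sum_i a i)%:E)%E.
  by rewrite mulr_sumr -sumEFin; apply: lee_sum => i _; exact: volE.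
move=> h1 h2.
have : (vol (overlap (u' *: x)) <= vol (overlap (v' *: x)) + ((v' - u') * \sum_i a i)%:E)%E.
  by apply: (le_trans h2); rewrite leeD2l.
rewrite -!EFin_covariogram -EFinD lee_fin /ray -/u' -/v' => h3.
have s0 : 0 <= \sum_i a i by rewrite sumr_ge0.
have : (v' - u') * \sum_i a i <= (v - u) * \sum_i a i by rewrite ler_wpM2r.
have : 0 <= v - u by rewrite subr_ge0.
lra.
Qed.

Let min_gaussian (x : 'M[R]_(m, n)) (y : 'rV[R]_n) : R :=
  \big[Num.min/gaussian K y]_(i < m) gaussian K (y - row i x).

Let min_gaussian_ge (x : 'M[R]_(m, n)) y (c : R) :
  (c <= min_gaussian x y) =
  (c <= gaussian K y) && [forall i, c <= gaussian K (y - row i x)].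
Proof.
apply/idP/andP => [cM|[cy /forallP cx]].
  split; first by apply: (le_trans cM); rewrite /min_gaussian; exact: bigmin_le_id.
  by apply/forallP => i; apply: (le_trans cM); rewrite /min_gaussian bigmin_le.
by apply/bigmin_geP; split=> // i _; exact: cx.
Qed.

Let min_gaussian_bounds (x : 'M[R]_(m, n)) y : 0 <= min_gaussian x y <= 1.
Proof.
have gb z : 0 <= gaussian K z <= 1 by exact: gaussian_bounds.
apply/andP; split.
  rewrite min_gaussian_ge; apply/andP; split; first by case/andP: (gb y).
  by apply/forallP => i; case/andP: (gb (y - row i x)).
apply: (@le_trans _ _ (gaussian K y)); last by case/andP: (gb y).
exact: bigmin_le_id.
Qed.

(** A minimum is above a level when all its terms are; each of the superlevel
    sets is a translate of [tau s] times [K], whence the overlap of [K] after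
    rescaling by [tau s]. *)
Let expRN_le_min (x : 'M[R]_(m, n)) y (s : R) : 0 < s ->
  (expR (- s) <= min_gaussian x y) =
  `[< overlap ((tau s)^-1 *: x) ((tau s)^-1 *: y) >].
Proof.
move=> s0; rewrite min_gaussian_ge (expRN_le_gaussian n K)//.
have rowE i : (tau s)^-1 *: (y - row i x) =
              (tau s)^-1 *: y - row i ((tau s)^-1 *: x).
  by apply/rowP => j; rewrite !mxE mulrBr.
apply/andP/asboolP => [[/asboolP Ky /forallP Kx]|[Ky Kx]].
  split=> // i; rewrite -rowE; apply/asboolP.
  by rewrite -(expRN_le_gaussian n K).
split; first exact/asboolP.
by apply/forallP => i; rewrite (expRN_le_gaussian n K)// rowE; exact/asboolP.
Qed.

(** The region under the graph of the minimum, with levels in the scale [s]. *)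
Let S (x : 'M[R]_(m, n)) : set (n.-tuple TR * TR) :=
  [set z | overlap ((tau z.2)^-1 *: x) ((tau z.2)^-1 *: row_of_tuple z.1)].

Let measurable_scaled_translate (v : 'rV[R]_n) :
  measurable [set z : n.-tuple TR * TR |
    K ((tau z.2)^-1 *: (row_of_tuple z.1 - v))].
Proof.
pose phi (z : n.-tuple TR * TR) : n.-tuple TR :=
  [tuple ((tau z.2)^-1 * (tnth z.1 i - v ord0 i))%R : TR | i < n].
have mphi : measurable_fun setT phi.
  apply/measurable_fun_tnthP => i.
  have -> : @tnth n TR ^~ i \o phi =
      (fun z => ((tau z.2)^-1 * (tnth z.1 i - v ord0 i))%R : TR).
    by apply/funext => z /=; rewrite tnth_mktuple.
  apply: measurable_funM; first exact: (measurableT_comp measurable_tauV measurable_snd).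
  apply: measurable_funB => //.
  exact: (measurableT_comp (measurable_tnth i) measurable_fst).
have := mphi measurableT _ mK; rewrite setTI; congr measurable.
by apply/seteqP; split=> z /=; congr K; apply/rowP => i;
  rewrite !mxE tnth_mktuple.
Qed.

Let measurable_S (x : 'M[R]_(m, n)) : measurable (S x).
Proof.
have -> : S x = [set z : n.-tuple TR * TR | K ((tau z.2)^-1 *: (row_of_tuple z.1 - 0))] `&`
    \bigcap_(i in [set: 'I_m])
      [set z | K ((tau z.2)^-1 *: (row_of_tuple z.1 - row i x))].
  have rowE (z : n.-tuple TR * TR) i : (tau z.2)^-1 *: (row_of_tuple z.1 - row i x) =
      (tau z.2)^-1 *: row_of_tuple z.1 - row i ((tau z.2)^-1 *: x).
    by apply/rowP => j; rewrite !mxE mulrBr.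
  apply/seteqP; split=> z /= [Kz zx].
    by split; [rewrite subr0|move=> i _ /=; rewrite rowE; exact: zx].
  by split; [rewrite subr0 in Kz|move=> i; rewrite -rowE; exact: zx].
apply: measurableI; first exact: measurable_scaled_translate.
apply: fin_bigcap_measurable => [|i _]; first exact: finite_finset.
exact: measurable_scaled_translate.
Qed.

Let integral_min_gaussian (x : 'M[R]_(m, n)) :
  (\int[lebesgue_tuple n]_t (min_gaussian x (row_of_tuple t))%:E =
   \int[mu]_(s in Rpos) (expR (- s) * tau s `^ n%:R *
                         covariogram K ((tau s)^-1 *: x))%:E)%E.
Proof.
pose f (z : n.-tuple TR * TR) : \bar R := (expR (- z.2) * \1_(S x) z)%:E.
have mf : measurable_fun setT f.
  apply/measurable_EFinP; apply: measurable_funM; last exact: measurable_indic.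
  exact: (measurableT_comp (measurable_expRN setT) measurable_snd).
have f0 z : (0 <= f z)%E by rewrite lee_fin mulr_ge0 ?expR_ge0.
have mRpos : measurable Rpos by exact: measurable_itv.
transitivity (\int[lebesgue_tuple n]_t \int[mu]_(s in Rpos) f (t, s))%E.
  apply: eq_integral => t _.
  rewrite -[LHS](layer_cake_expR _ (min_gaussian_bounds x (row_of_tuple t))).
  apply: eq_integral => s; rewrite inE => /Rpos_gt0 s0.
  by rewrite expRN_le_min// /f /= indicE.
rewrite (@fubini_tonelli_in R _ _ _ _ (lebesgue_tuple n) mu setT Rpos measurableT mRpos f mf f0).
apply: eq_integral => s; rewrite inE => /Rpos_gt0 s0.
have t0 := tau_gt0 s s0.
have mSs : measurable (ysection (S x) s) by exact: measurable_ysection.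
transitivity ((expR (- s))%:E * \int[lebesgue_tuple n]_t (\1_(ysection (S x) s) t)%:E)%E.
  rewrite -ge0_integralZl_EFin ?expR_ge0//; last first.
    by apply/measurable_EFinP; exact: measurable_indic.
  apply: eq_integral => t _; rewrite /f /= EFinM; congr (_ * _%:E)%E.
  by rewrite !indicE mem_ysection.
rewrite integral_indic// setIT -mulrA EFinM; congr (_ * _)%E.
rewrite EFinM EFin_covariogram powR_mulrn ?powR_ge0//.
have ti0 : 0 < (tau s)^-1 by rewrite invr_gt0.
have := vol_affine n (tau s)^-1 0 _ ti0 (measurable_overlap ((tau s)^-1 *: x)).
rewrite invrK => <-.
congr (lebesgue_tuple n _); apply/seteqP; split=> t; rewrite /ysection/= inE/=.
  by rewrite /preimage/= addr0.
by rewrite /preimage/= addr0.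
Qed.

(** The layer-cake formula for the minimum, integrated over the space by Tonelli's
    theorem.  The finiteness of the mixture is shown apart, since the covariogram
    of the Gaussian is a real-valued integral. *)
Lemma covariogram_gaussian (x : 'M[R]_(m, n)) :
  (\int[mu]_(s in Rpos) (expR (- s) * tau s `^ n%:R *
                         covariogram K ((tau s)^-1 *: x))%:E =
  (covariogram_fun (gaussian K) x)%:E)%E.
Proof.
have fin : ((\int[mu]_(s in Rpos) (expR (- s) * tau s `^ n%:R *
                         covariogram K ((tau s)^-1 *: x))%:E) \is a fin_num)%E.
  have n20 : 0 <= n%:R / 2 :> R by rewrite divr_ge0.
  set C := 2 `^ (n%:R / 2) * covariogram K (0 : 'M[R]_(m, n)).
  have C0 : 0 <= C by rewrite mulr_ge0 ?powR_ge0// covariogram_ge0.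
  rewrite ge0_fin_numE; last first.
    apply: integral_ge0 => s _.
    by rewrite lee_fin !mulr_ge0 ?expR_ge0 ?powR_ge0// covariogram_ge0.
  apply: (@le_lt_trans _ _ (\int[mu]_(s in Rpos) (C%:E * (s `^ (n%:R / 2) * expR (- s))%:E))%E).
    apply: ge0_le_integral => //.
    - by move=> s _; rewrite lee_fin !mulr_ge0 ?expR_ge0 ?powR_ge0// covariogram_ge0.
    - apply: (@eq_measurable_fun _ _ _ _ _ (fun s : TR => (expR (- s) * tau s `^ n%:R * ray x (tau s)^-1)%:E)).
        by move=> s; rewrite inE => /Rpos_gt0 s0; rewrite rayE// invr_ge0 ltW// tau_gt0.
      apply/measurable_EFinP; apply: measurable_funTS.
      apply: measurable_funM; last exact: (measurableT_comp (measurable_ray x) measurable_tauV).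
      apply: measurable_funM; first exact: measurable_expRN.
      apply: (measurableT_comp (measurable_powR _)).
      by apply: (measurableT_comp (measurable_powR _)); exact: measurable_funM.
    - apply: measurable_funeM; apply/measurable_EFinP; exact: measurable_gamma_integrand.
    - move=> s /Rpos_gt0 s0; rewrite -EFinM lee_fin tau_powR// /C.
      have := covariogram_le ((tau s)^-1 *: x).
      move=> /(ler_wpM2l (mulr_ge0 (mulr_ge0 (expR_ge0 (- s)) (powR_ge0 2 (n%:R/2))) (powR_ge0 s (n%:R/2)))).
      lra.
  rewrite ge0_integralZl_EFin//; last 2 first.
  - by move=> s _; rewrite lee_fin mulr_ge0 ?powR_ge0 ?expR_ge0.
  - apply/measurable_EFinP; exact: measurable_gamma_integrand.
  by rewrite EFin_Gamma// -EFinM ltry.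
rewrite /covariogram_fun /integral_rV /Rintegral.
by rewrite integral_min_gaussian fineK.
Qed.

End covariogram.

(** * Radial functions *)

Section radial.
Context {R : realType}.
Local Notation TR := (measurableTypeR R).
Local Notation mu := (@lebesgue_measure R).
Local Notation Rpos := (`]0%R, +oo[%classic : set TR).
Variables (m n : nat) (K : set 'rV[R]_n).
Hypothesis (hm : (0 < m)%N) (hn : (0 < n)%N) (hK : convex_body K) (K0 : K 0).
Local Notation gK := (@covariogram R m n K).
Local Notation gG := (@covariogram_fun R m n (gaussian K)).
Local Notation a := (n%:R / 2 : R).
Local Notation c_n := (2 `^ (n%:R / 2) * Gamma (1 + n%:R / 2) : R).

(** Were all the entries smaller, the sum of their squares would be at most
    [1 / 2]. *)
Lemma euclid_norm_entry (theta : 'M[R]_(m, n)) : euclid_norm theta = 1 ->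
  exists i j, (2 * (m * n)%:R)^-1 <= `|theta i j|.
Proof.
move=> t1; apply: contrapT => H.
set N : R := (2 * (m * n)%:R)^-1 in H.
have mn0 : (0 : R) < (m * n)%:R by rewrite ltr0n muln_gt0 hm.
have N0 : 0 < N by rewrite invr_gt0 mulr_gt0.
have N1 : N <= 1.
  rewrite invf_le1 ?mulr_gt0//; have : (1 : R) <= (m * n)%:R by rewrite ler1n muln_gt0 hm.
  lra.
have tN i j : theta i j ^+ 2 <= N.
  have tij : `|theta i j| <= N.
    by rewrite leNgt; apply/negP => Nt; apply: H; exists i, j; exact: ltW.
  rewrite -real_normK ?num_real// expr2.
  by rewrite -[leRHS]mulr1 ler_pM// (le_trans tij).
have : \sum_i \sum_j theta i j ^+ 2 <= \sum_(i < m) \sum_(j < n) N.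
  by apply: ler_sum => i _; apply: ler_sum => j _; exact: tN.
rewrite !sumr_const !card_ord -mulrnA mulnC -mulr_natr /N.
have -> : (2 * (m * n)%:R)^-1 * (m * n)%:R = 2^-1 :> R.
  by rewrite invfM -mulrA mulVf ?mulr1// gt_eqF.
have -> : \sum_i \sum_j theta i j ^+ 2 = 1.
  have s0 : 0 <= \sum_i \sum_j theta i j ^+ 2.
    by apply: sumr_ge0 => i _; apply: sumr_ge0 => j _; exact: sqr_ge0.
  by rewrite -[LHS]sqr_sqrtr// -/(euclid_norm theta) t1 expr1n.
lra.
Qed.

(** A body of radius less than [M] is disjoint from its translates by more than
    [2 M] in some coordinate, and one coordinate of a unit direction is bounded
    below. *)
Lemma ray_support : exists2 D : R, 0 < D &
  forall theta : 'M[R]_(m, n), euclid_norm theta = 1 ->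
  forall u, D <= u -> ray m n K theta u = 0.
Proof.
have [cK _ _] := hK.
have [M M0 KM] := bounded_sub_ball n K (compact_bounded cK).
have mn0 : (0 : R) < (m * n)%:R by rewrite ltr0n muln_gt0 hm.
exists (2 * M * (2 * (m * n)%:R)); first by rewrite !mulr_gt0.
move=> theta /euclid_norm_entry[i [j tij]] u Du.
have N0 : (0 : R) < 2 * (m * n)%:R by rewrite mulr_gt0.
have u0 : 0 < u by apply: lt_le_trans Du; rewrite !mulr_gt0.
have ov0 : overlap m n K (u *: theta) = set0.
  apply/seteqP; split=> // y [Ky /(_ i) Kyu].
  have [_ /(_ ord0 j)] := KM _ Ky; have [_ /(_ ord0 j)] := KM _ Kyu.
  rewrite /ball/= !mxE !sub0r !normrN => h1 h2.
  have : `|u * theta i j| < 2 * M.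
    have -> : u * theta i j = y ord0 j - (y ord0 j - u * theta i j) by ring.
    by rewrite (le_lt_trans (ler_normB _ _))//; lra.
  rewrite normrM (ger0_norm (ltW u0)) ltNge => /negP; apply.
  apply: (@le_trans _ _ (u * (2 * (m * n)%:R)^-1)); last by rewrite ler_wpM2l// ltW.
  by rewrite ler_pdivlMr.
apply: EFin_inj; rewrite rayE ?(ltW u0)// EFin_covariogram// ov0.
by rewrite /vol preimage_set0 measure0.
Qed.

Let n0 : 0 <= a. Proof. by rewrite divr_ge0. Qed.

Let G0 : 0 < Gamma (1 + a). Proof. exact: Gamma_gt0. Qed.

Let cn0 : 0 < c_n. Proof. by rewrite mulr_gt0// powR_gt0. Qed.

Let gK0 : 0 < gK 0. Proof. exact: covariogram0_gt0. Qed.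

Lemma covariogram_gaussian_ray (theta : 'M[R]_(m, n)) (r : R) : 0 <= r ->
  ((gG (r *: theta))%:E = \int[mu]_(s in Rpos)
     (expR (- s) * tau s `^ n%:R * ray m n K theta (r / tau s))%:E)%E.
Proof.
move=> r0; rewrite -covariogram_gaussian//; apply: eq_integral => s.
rewrite inE => /Rpos_gt0 s0; have t0 := tau_gt0 s s0.
by rewrite rayE ?divr_ge0 ?(ltW t0)// scalerA [(tau s)^-1 * r]mulrC.
Qed.

Lemma covariogram_gaussian0 : gG 0 = c_n * gK 0.
Proof.
apply: EFin_inj; have := covariogram_gaussian_ray 0 0 (lexx 0); rewrite scaler0 => ->.
rewrite -mulrA [Gamma _ * _]mulrC mulrA EFinM -EFin_Gamma// -ge0_integralZl_EFin//.
- apply: eq_integral => s; rewrite inE => /Rpos_gt0 s0.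
  by rewrite mul0r ray_np// tau_powR// -EFinM; congr EFin; ring.
- by move=> s _; rewrite lee_fin mulr_ge0 ?powR_ge0 ?expR_ge0.
- by apply/measurable_EFinP; exact: measurable_gamma_integrand.
- by rewrite mulr_ge0 ?powR_ge0// ltW.
Qed.

Lemma fine_pMl (c : R) (x : \bar R) : 0 < c -> fine (c%:E * x)%E = c * fine x.
Proof.
move=> c0; case: x => [r| |] //=; first by rewrite gt0_muley ?lte_fin//= mulr0.
by rewrite gt0_muleNy ?lte_fin//= mulr0.
Qed.

(** The moment of order [p] of the profile of the Gaussian is a constant times that
    of the profile of the body, by [gamma_mixture_moment]; one factor of it
    is cancelled by the value of the Gaussian covariogram at the origin. *)
Lemma radial_gaussian (p : R) (theta : 'M[R]_(m, n)) : 0 < p ->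
  radial gG p theta =
  Num.sqrt 2 * (Gamma (1 + (n%:R + p) / 2) / Gamma (1 + n%:R / 2)) `^ p^-1 *
  radial gK p theta.
Proof.
move=> p0; rewrite /radial gt_eqF//.
have np0 : 0 <= (n%:R + p) / 2 by rewrite divr_ge0// addr_ge0// ltW.
have Gp0 := Gamma_gt0 _ np0.
set C := 2 `^ ((n%:R + p) / 2) * Gamma (1 + (n%:R + p) / 2).
have C0 : 0 < C by rewrite mulr_gt0// powR_gt0.
set I := \int[mu]_(r in `]0, +oo[) (gK (r *: theta) * r `^ (p - 1)).
have I0 : 0 <= I.
  by apply: Rintegral_ge0 => r _; rewrite mulr_ge0 ?powR_ge0// covariogram_ge0.
have -> : \int[mu]_(r in `]0, +oo[) (gG (r *: theta) * r `^ (p - 1)) = C * I.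
  rewrite /I /Rintegral -fine_pMl//; congr fine.
  transitivity (\int[mu]_(r in Rpos) \int[mu]_(s in Rpos)
      (expR (- s) * tau s `^ n%:R * ray m n K theta (r / tau s) * r `^ (p - 1))%:E)%E.
    apply: eq_integral => r; rewrite inE => /Rpos_gt0 r0.
    rewrite mulrC EFinM covariogram_gaussian_ray ?ltW// -ge0_integralZl_EFin ?powR_ge0//.
    - by apply: eq_integral => s _; rewrite -EFinM mulrC.
    - by move=> s _; rewrite lee_fin !mulr_ge0 ?expR_ge0 ?powR_ge0// covariogram_ge0.
    - apply/measurable_EFinP; apply: measurable_funTS.
      apply: measurable_funM.
        apply: measurable_funM; first exact: measurable_expRN.
        apply: (measurableT_comp (measurable_powR _)).
        by apply: (measurableT_comp (measurable_powR _)); exact: measurable_funM.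
      have m2 : measurable_fun [set: TR] (fun s : TR => r / tau s : R).
        by apply: measurable_funM => //; exact: measurable_tauV.
      have m1 : measurable_fun [set: TR] (ray m n K theta) by exact: measurable_ray.
      exact: (measurableT_comp m1 m2).
  rewrite gamma_mixture_moment//.
  - congr (_ * _)%E; apply: eq_integral => r; rewrite inE => /Rpos_gt0 r0.
    by rewrite rayE// ltW.
  - exact: measurable_ray.
  - by move=> u; exact: covariogram_ge0.
rewrite covariogram_gaussian0.
have -> : p / (c_n * gK 0) * (C * I) =
  2 `^ (p / 2) * (Gamma (1 + (n%:R + p) / 2) / Gamma (1 + n%:R / 2)) * (p / gK 0 * I).
  have -> : C = 2 `^ a * 2 `^ (p / 2) * Gamma (1 + (n%:R + p) / 2).
    rewrite /C mulrDl powRD //.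
    by apply/implyP => _; rewrite gt_eqF.
  field.
  by rewrite !gt_eqF// powR_gt0.
rewrite powRM ?mulr_ge0 ?divr_ge0 ?powR_ge0 ?(ltW Gp0) ?(ltW G0) ?(ltW p0) ?invr_ge0 ?(ltW G0) ?(ltW gK0)//.
congr (_ * _); rewrite powRM ?powR_ge0 ?divr_ge0 ?(ltW Gp0) ?(ltW G0) ?invr_ge0 ?(ltW G0)//.
congr (_ * _); rewrite -powRrM -powR12_sqrt//; congr powR.
by field; rewrite gt_eqF.
Qed.

Lemma sqrt2E : Num.sqrt 2 = expR (2^-1 * ln 2) :> R.
Proof. by rewrite -powR12_sqrt// /powR gt_eqF. Qed.

(** Normalised by their values at 0, the profiles of the body and of its Gaussian
    are the tails [h] and [H] of a variable and of its product with an
    independent [tau S]. *)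
Lemma radial_gaussian0 (theta : 'M[R]_(m, n)) : euclid_norm theta = 1 ->
  radial gG 0 theta =
  Num.sqrt 2 * expR (2^-1 * digamma (1 + n%:R / 2)) * radial gK 0 theta.
Proof.
move=> t1; rewrite /radial eqxx.
have [D D0 suppD] := ray_support.
have [L L0 lipL] := ray_lipschitz m n K hK theta hn.
pose h0 (u : R) := ray m n K theta u / gK 0.
pose h (u : R) := gK (u *: theta) / gK 0.
pose H (u : R) := gG (u *: theta) / gG 0.
have h0E u : 0 <= u -> h0 u = h u by move=> u0; rewrite /h0 rayE.
have h0_ni : {homo h0 : x y /~ x <= y}.
  by move=> x y xy; rewrite /h0 ler_pM2r ?invr_gt0//; exact: ray_nonincreasing xy.
have L0' : 0 < L / gK 0 by rewrite divr_gt0.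
have h0_lip x y : x <= y -> h0 x - h0 y <= L / gK 0 * (y - x).
  move=> xy; rewrite /h0 -mulrBl mulrAC ler_pM2r ?invr_gt0//.
  exact: lipL.
have h0_1 x : x <= 0 -> h0 x = 1 by move=> x0; rewrite /h0 ray_np// mulfV// gt_eqF.
have h0_0 x : D <= x -> h0 x = 0 by move=> Dx; rewrite /h0 suppD// mul0r.
have [phi [mphi phi_bnd phiD tail]] :=
  exists_density h0 _ D h0_ni L0' h0_lip h0_1 h0_0.
(* a dimension at least 1 gives the exponent 1/2 that integrates 1 / tau *)
have a_ge : (2^-1 : R) <= a.
  by rewrite -[leLHS]mul1r ler_pM2r ?invr_gt0// ler1n.
have HE r : 0 <= r -> (\int[mu]_(s in Rpos)
    (s `^ a * expR (- s) / Gamma (1 + a) * h (r / tau s))%:E = (H r)%:E)%E.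
  move=> r0; have -> : H r = (gG 0)^-1 * gG (r *: theta) by rewrite /H mulrC.
  rewrite EFinM covariogram_gaussian_ray//.
  rewrite -ge0_integralZl_EFin//.
  - apply: eq_integral => s; rewrite inE => /Rpos_gt0 s0.
    rewrite -EFinM tau_powR// covariogram_gaussian0 -h0E; last first.
      by rewrite divr_ge0// ltW// tau_gt0.
    rewrite /h0; congr EFin; field.
    by rewrite !gt_eqF// powR_gt0.
  - by move=> s _; rewrite lee_fin !mulr_ge0 ?expR_ge0 ?powR_ge0// covariogram_ge0.
  - apply/measurable_EFinP; apply: measurable_funTS.
    apply: measurable_funM.
      apply: measurable_funM; first exact: measurable_expRN.
      apply: (measurableT_comp (measurable_powR _)).
      by apply: (measurableT_comp (measurable_powR _)); exact: measurable_funM.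
    have m2 : measurable_fun [set: TR] (fun s : TR => r / tau s : R).
      by apply: measurable_funM => //; exact: measurable_tauV.
    have m1 : measurable_fun [set: TR] (ray m n K theta) by exact: measurable_ray.
    exact: (measurableT_comp m1 m2).
  - by rewrite invr_ge0 covariogram_gaussian0 mulr_ge0// ltW.
have h1 : h 0 = 1 by rewrite -h0E// h0_1.
have tailh r : 0 <= r -> (\int[mu]_(s in `]r, +oo[) (phi s)%:E = (h r)%:E)%E.
  by move=> r0; rewrite tail// h0E.
have -> := @log_moment_mixture_density R a _ D h H a_ge HE phi mphi phi_bnd phiD h1 tailh.
rewrite expRD [RHS]mulrC; congr (_ * _).
by rewrite mulrDr expRD sqrt2E.
Qed.

Lemma star_set_dilate (c : R) (rho rho' : 'M[R]_(m, n) -> R) : 0 < c ->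
  (forall theta, euclid_norm theta = 1 -> rho' theta = c * rho theta) ->
  star_set rho' = dilate c (star_set rho).
Proof.
move=> c0 rhoE; apply/seteqP; split=> [x [theta [r [t1 /andP[r0 rr] ->]]]|].
  exists ((r / c) *: theta); last by rewrite scalerA mulrC divfK ?gt_eqF.
  exists theta, (r / c); split=> //; rewrite divr_ge0 ?(ltW c0)//=.
  by rewrite ler_pdivrMr// mulrC -rhoE.
move=> _ [_ [theta [r [t1 /andP[r0 rr] ->]]] <-].
exists theta, (c * r); split=> //; last by rewrite scalerA.
by rewrite mulr_ge0 ?(ltW c0)//= rhoE// ler_pM2l.
Qed.

(** The profile is at most its value at 0, and vanishes beyond [D]; the remaining
    constant [p^(1/p)] is at most [expR 1]. *)
Lemma radial_covariogram_le : exists2 D : R, 0 < D &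
  forall (p : R) (theta : 'M[R]_(m, n)), 1 <= p -> euclid_norm theta = 1 ->
  radial gK p theta <= expR 1 * D.
Proof.
have [D D0 suppD] := ray_support; exists D => // p theta p1 t1.
have p0 : 0 < p by exact: lt_le_trans p1.
rewrite /radial gt_eqF//.
set I := \int[mu]_(r in `]0, +oo[) (gK (r *: theta) * r `^ (p - 1)).
have I0 : 0 <= I.
  by apply: Rintegral_ge0 => r _; rewrite mulr_ge0 ?powR_ge0// covariogram_ge0.
have ID : I <= gK 0 * D `^ p.
  have : (\int[mu]_(r in Rpos) (gK (r *: theta) * r `^ (p - 1))%:E <= (gK 0 * D `^ p)%:E)%E.
    set c := gK 0 * D `^ (p - 1).
    have c0 : 0 <= c by rewrite mulr_ge0 ?powR_ge0// ltW.
    apply: (@le_trans _ _ (\int[mu]_(r in Rpos) (c * \1_(`]0, D] : set TR) r)%:E)%E).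
      apply: ge0_le_integral => //.
      - by move=> r _; rewrite lee_fin mulr_ge0 ?powR_ge0// covariogram_ge0.
      - apply/measurable_EFinP.
        apply: (eq_measurable_fun (fun r : TR => ray m n K theta r * r `^ (p - 1) : R)).
          by move=> r; rewrite inE => /Rpos_gt0 r0; rewrite rayE// ltW.
        apply: measurable_funTS; apply: measurable_funM; first exact: measurable_ray.
        exact: measurable_powR.
      - apply/measurable_EFinP; apply: measurable_funTS.
        by apply: measurable_funM => //; exact: measurable_indic.
      - move=> r /Rpos_gt0 r0; rewrite lee_fin indicE.
        have [rD|Dr] := leP r D.
          rewrite mem_set ?mulr1; last by rewrite /= in_itv/= r0.
          apply: ler_pM; rewrite ?covariogram_ge0 ?powR_ge0 ?covariogram_le//.
          by rewrite ge0_ler_powR ?nnegrE ?subr_ge0// ?(ltW r0) ?(ltW D0).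
        by rewrite -rayE ?(ltW r0)// suppD ?(ltW Dr)// mul0r mulr_ge0.
    under eq_integral do rewrite EFinM.
    rewrite ge0_integralZl_EFin//; last first.
      by apply/measurable_EFinP; apply: measurable_funTS; exact: measurable_indic.
    rewrite integral_indic//.
    rewrite setIidl; last by move=> r /=; rewrite !in_itv/= andbT => /andP[].
    have muD : mu (`]0%R, D] : set TR) = D%:E.
      by apply: etrans (lebesgue_measure_itv _) _; rewrite /= lte_fin D0 sube0.
    change (c%:E * mu (`]0%R, D] : set TR) <= (gK 0 * D `^ p)%:E)%E.
    rewrite muD -EFinM lee_fin /c -mulrA.
    rewrite ler_pM2l// -[X in _ * X](powRr1 (ltW D0)) -powRD ?subrK//.
    by apply/implyP => _; rewrite gt_eqF.
  move=> Ile; rewrite -lee_fin /I /Rintegral fineK//.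
  rewrite ge0_fin_numE; first by rewrite (le_lt_trans Ile)// ltry.
  apply: integral_ge0 => r _; rewrite lee_fin mulr_ge0 ?powR_ge0//.
  exact: covariogram_ge0.
apply: (@le_trans _ _ ((expR p * D `^ p) `^ p^-1)).
  rewrite ge0_ler_powR ?nnegrE ?invr_ge0 ?(ltW p0)//.
  - by rewrite mulr_ge0// divr_ge0// ?(ltW p0) ?(ltW gK0).
  - by rewrite mulr_ge0 ?expR_ge0 ?powR_ge0.
  apply: (@le_trans _ _ (p * D `^ p)).
    rewrite -mulrA ler_pM2l// mulrC ler_pdivrMr// mulrC; lra.
  rewrite ler_wpM2r ?powR_ge0//; have := expR_ge1Dx p; lra.
rewrite powRM ?expR_ge0 ?powR_ge0// -powRrM mulfV ?gt_eqF// powRr1 ?(ltW D0)//.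
rewrite ler_wpM2r ?(ltW D0)// /powR gt_eqF ?expR_gt0// expRK mulVf//.
by rewrite gt_eqF.
Qed.

End radial.

(** * The limit of large exponents *)

Section limit.
Context {R : realType}.

(** By [Gamma_half_le], the left-hand side is at most [C^(1/p) * A^(-1/2)] for a
    [C] that depends on [A] and [a] only.  The choice of [A] makes [A^(-1/2)]
    equal to [eps / expR 1], and [C^(1/p)] is at most [expR 1] for large [p]. *)
Lemma gamma_ratio_root_le (a eps : R) : 0 <= a -> 0 < eps ->
  \forall p \near +oo,
    Gamma (1 + p) `^ (- p^-1) *
    (Gamma (1 + (a + p) / 2) / Gamma (1 + a / 2)) `^ p^-1 <= eps :> R.
Proof.
move=> a0 eps0.
have a20 : 0 <= a / 2 by rewrite divr_ge0.
have G0 : 0 < Gamma (1 + a / 2) :> R by exact: Gamma_gt0.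
pose A : R := (expR 1 / eps) ^+ 2.
have E0 : 0 < expR 1 / eps by rewrite divr_gt0 ?expR_gt0.
have A0 : 0 < A by rewrite exprn_gt0.
have AE : A `^ (- 2^-1) = eps / expR 1.
  by rewrite powRN powR12_sqrt ?(ltW A0)// sqrtr_sqr ger0_norm ?(ltW E0)// invf_div.
pose C : R := A `^ (a / 2) * (expR A + 1) / Gamma (1 + a / 2).
have C0 : 0 < C.
  by rewrite divr_gt0// mulr_gt0 ?powR_gt0// addr_gt0 ?expR_gt0.
near=> p.
have p0 : 0 < p by near: p; exact: nbhs_pinfty_gt.
have ap : a <= p by near: p; apply: nbhs_pinfty_ge; exact: num_real.
have Cp : ln C <= p by near: p; apply: nbhs_pinfty_ge; exact: num_real.
have p00 : 0 <= p by exact: ltW.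
have Gp : 0 < Gamma (1 + p) :> R by exact: Gamma_gt0.
have Gap : 0 < Gamma (1 + (a + p) / 2) :> R.
  by apply: Gamma_gt0; rewrite divr_ge0// addr_ge0.
have pV0 : 0 <= p^-1 by rewrite invr_ge0.
apply: (@le_trans _ _ (Gamma (1 + p) `^ (- p^-1) *
    (C * A `^ (- (2^-1 * p)) * Gamma (1 + p)) `^ p^-1)).
  rewrite ler_wpM2l ?powR_ge0// ge0_ler_powR ?nnegrE//.
  - exact: (divr_ge0 (ltW Gap) (ltW G0)).
  - exact: (mulr_ge0 (mulr_ge0 (ltW C0) (powR_ge0 _ _)) (ltW Gp)).
  rewrite (ler_pdivrMr _ _ G0).
  apply: (le_trans (Gamma_half_le _ _ _ a0 ap A0)).
  rewrite mulrBl powRD; last by apply/implyP => _; rewrite gt_eqF.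
  rewrite [2^-1 * p]mulrC /C le_eqVlt; apply/orP; left; apply/eqP.
  move: G0; move: (Gamma (1 + a / 2)) (Gamma (1 + p)) => g q g0.
  by field; rewrite gt_eqF.
rewrite (powRM _ (mulr_ge0 (ltW C0) (powR_ge0 _ _)) (ltW Gp)).
rewrite (powRM _ (ltW C0) (powR_ge0 _ _)).
rewrite -powRrM mulNr mulfK ?gt_eqF// AE.
rewrite mulrCA -powRD; last by apply/implyP => _; rewrite gt_eqF.
rewrite addNr powRr0 mulr1 mulrCA -[leRHS]mulr1 ler_pM2l//.
rewrite ler_pdivrMr ?expR_gt0// mul1r /powR gt_eqF// ler_expR.
by rewrite mulrC ler_pdivrMr// mul1r.
Unshelve. all: by end_near. Qed.

Lemma cvge0_pinfty (h : R -> \bar R) :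
  (forall eps : R, 0 < eps -> \forall p \near +oo, (0 <= h p <= eps%:E)%E) ->
  h p @[p --> +oo] --> 0%E.
Proof.
move=> hle; apply/fine_cvgP; split.
  near=> p; have /andP[h0 h1] : (0 <= h p <= 1%:E)%E.
    by near: p; exact: hle.
  by rewrite ge0_fin_numE// (le_lt_trans h1)// ltry.
apply/cvgrPdist_le => eps eps0; near=> p.
have /andP[] : (0 <= h p <= eps%:E)%E by near: p; exact: hle.
rewrite /= sub0r normrN; case: (h p) => [r| |]//.
by rewrite !lee_fin => r0 rle; rewrite ger0_norm.
Unshelve. all: by end_near. Qed.

Lemma euclid_norm0 m n : euclid_norm (0 : 'M[R]_(m, n)) = 0.
Proof.
rewrite /euclid_norm big1 ?sqrtr0// => i _.
by rewrite big1// => j _; rewrite mxE expr0n.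
Qed.

Lemma euclid_normZ m n (c : R) (x : 'M[R]_(m, n)) :
  euclid_norm (c *: x) = `|c| * euclid_norm x.
Proof.
rewrite /euclid_norm -sqrtr_sqr -sqrtrM ?sqr_ge0//; congr Num.sqrt.
rewrite mulr_sumr; apply: eq_bigr => i _; rewrite mulr_sumr.
by apply: eq_bigr => j _; rewrite mxE exprMn.
Qed.

Lemma euclid_norm_delta m n (i : 'I_m) (j : 'I_n) :
  euclid_norm (delta_mx i j : 'M[R]_(m, n)) = 1.
Proof.
rewrite /euclid_norm (bigD1 i)//= (bigD1 j)//= !mxE !eqxx expr1n.
rewrite big1 => [|k /negPf kj]; last by rewrite mxE kj andbF expr0n.
rewrite big1 => [|k /negPf ki]; first by rewrite !addr0 sqrtr1.
by rewrite big1// => l _; rewrite mxE ki expr0n.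
Qed.

Lemma radial_ge0 m n (g : 'M[R]_(m, n) -> R) (p : R) theta : 0 <= radial g p theta.
Proof. by rewrite /radial; case: ifP => _; [exact: expR_ge0|exact: powR_ge0]. Qed.

Lemma star_set0 m n (rho : 'M[R]_(m, n) -> R) : (0 < m)%N -> (0 < n)%N ->
  (forall theta, 0 <= rho theta) -> star_set rho 0.
Proof.
move=> m0 n0 rho0; exists (delta_mx (Ordinal m0) (Ordinal n0)), 0.
by rewrite euclid_norm_delta lexx rho0 scale0r.
Qed.

Lemma hausdorff_singleton0 m n (B : set 'M[R]_(m, n)) (r : R) : B 0 ->
  (forall x, B x -> euclid_norm x <= r) -> (0 <= hausdorff B [set 0%R] <= r%:E)%E.
Proof.
move=> B0 Br; rewrite /hausdorff /hausdorff_excess.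
have excess a : ereal_inf [set (euclid_norm (a - b))%:E | b in [set 0%R]] =
    (euclid_norm (a : 'M[R]_(m, n)))%:E by rewrite image_set1 subr0 ereal_inf1.
apply/andP; split.
  rewrite le_max; apply/orP; left; apply: ereal_sup_ubound.
  by exists 0 => //; rewrite excess euclid_norm0.
rewrite ge_max; apply/andP; split; apply: ge_ereal_sup => _ [a Ba <-].
  by rewrite excess lee_fin Br.
rewrite Ba; apply: (@le_trans _ _ 0%E); last by rewrite lee_fin -(euclid_norm0 m n) Br.
by apply: ereal_inf_lbound; exists 0 => //; rewrite subr0 euclid_norm0.
Qed.

End limit.

Theorem corollary1p5 (R : realType) (m n : nat) (K : set 'rV[R]_n)
    (hm : (0 < m)%N) (hn : (0 < n)%N) (hK : convex_body K) (hK0 : K 0) :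
  [/\ radial_mean_body_fun m 0 (gaussian K) =
        dilate (Num.sqrt 2 * expR (2^-1 * digamma (1 + n%:R / 2)))
          (radial_mean_body m 0 K),
      forall p : R, 0 < p ->
        radial_mean_body_fun m p (gaussian K) =
          dilate (Num.sqrt 2 *
                  (Gamma (1 + (n%:R + p) / 2) / Gamma (1 + n%:R / 2)) `^ p^-1)
            (radial_mean_body m p K)
    & hausdorff (dilate (Gamma (1 + p) `^ (- p^-1))
                   (radial_mean_body_fun m p (gaussian K))) [set 0]
        @[p --> +oo] --> 0%E].
Proof.
have sqrt2_gt0 : 0 < Num.sqrt 2 :> R by rewrite sqrtr_gt0.
split.
- apply: star_set_dilate; first by rewrite mulr_gt0// expR_gt0.
  by move=> theta t1; exact: radial_gaussian0.
- move=> p p0; apply: star_set_dilate.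
    rewrite mulr_gt0// powR_gt0// divr_gt0// Gamma_gt0// divr_ge0//.
    by rewrite addr_ge0// ltW.
  by move=> theta _; exact: radial_gaussian.
have [D D0 radD] := radial_covariogram_le m n K hm hn hK.
apply: cvge0_pinfty => eps eps0.
have c0 : 0 < Num.sqrt 2 * (expR 1 * D) by rewrite !mulr_gt0// expR_gt0.
near=> p.
have p1 : 1 <= p by near: p; apply: nbhs_pinfty_ge; exact: num_real.
have p0 : 0 < p by exact: lt_le_trans p1.
have small : Gamma (1 + p) `^ (- p^-1) *
    (Gamma (1 + (n%:R + p) / 2) / Gamma (1 + n%:R / 2)) `^ p^-1 <=
    eps / (Num.sqrt 2 * (expR 1 * D)).
  by near: p; apply: gamma_ratio_root_le => //; rewrite divr_gt0.
apply: hausdorff_singleton0.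
  exists 0; last by rewrite scaler0.
  by apply: star_set0 => // theta; exact: radial_ge0.
move=> _ [_ [theta [r [t1 /andP[r0 rle] ->]]] <-].
rewrite !euclid_normZ t1 mulr1 (ger0_norm r0) ger0_norm ?powR_ge0//.
move: rle; rewrite radial_gaussian// => rle.
rewrite -(divfK (lt0r_neq0 c0) eps).
apply: (@le_trans _ _ (Gamma (1 + p) `^ (- p^-1) *
    (Gamma (1 + (n%:R + p) / 2) / Gamma (1 + n%:R / 2)) `^ p^-1 *
    (Num.sqrt 2 * (expR 1 * D)))); last by rewrite ler_pM2r.
rewrite -mulrA ler_wpM2l ?powR_ge0//; apply: (le_trans rle).
rewrite [Num.sqrt 2 * _]mulrC -!mulrA ler_wpM2l ?powR_ge0//.
by rewrite ler_wpM2l ?(ltW sqrt2_gt0)// radD.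
Unshelve. all: by end_near. Qed.
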